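(* For every $m\in(1,\infty)$ there exists $\beta_0>0$ such that for all $0<\beta<\beta_0$ the constant state $\rho_\infty$ is the unique stationary solution in $\mathcal P(\Omega)\cap L^m(\Omega)$ of $$\partial_t\rho=\beta^{-1}\Delta\rho^m+\nabla\cdot(\rho\,\nabla W\star\rho)\quad\text{on }\Omega,$$ and the unique minimiser of the free energy $\mathcal F_\beta^m$ over $\mathcal P(\Omega)$.
   Context: $\Omega=\mathbb T^d$ is the torus of side length $L>0$, $\rho_\infty:=L^{-d}=|\Omega|^{-1}$; $\mathcal P(\Omega)$ is the set of Borel probability measures on $\Omega$, identified with their densities when these exist. $W\in C^2(\Omega)$ is even along every coordinate and has mean zero; $\star$ is convolution on $\Omega$. Stationary solution: a bounded measurable $\rho\in\mathcal P(\Omega)\cap L^m(\Omega)$ with $\rho^m\in H^1(\Omega)$ solving $\beta^{-1}\Delta\rho^m+\nabla\cdot(\rho\nabla W\star\rho)=0$ weakly, i.e. $\int_\Omega(\beta^{-1}\nabla\rho^m+\rho\nabla(W\star\rho))\cdot\nabla\phi\,dx=0$ for all $\phi\in H^1(\Omega)$. For $m>1$, $$\mathcal F_\beta^m(\rho)=\frac{\beta^{-1}}{m-1}\int_\Omega\rho^m\,dx-\frac{\beta^{-1}}{m-1}+\frac12\iint_{\Omega\times\Omega}W(x-y)\rho(x)\rho(y)\,dx\,dy$$ whenever these quantities are finite, and $+\infty$ otherwise. *)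

(* Defs.v *)
From HB Require Import structures.
From mathcomp Require Import all_boot all_order all_algebra lra.
From mathcomp Require Import all_classical all_reals all_analysis.
Import numFieldNormedType.Exports.
Import Order.TTheory GRing.Theory Num.Theory.

Set Implicit Arguments.
Unset Strict Implicit.
Unset Printing Implicit Defensive.

Local Open Scope classical_set_scope.
Local Open Scope ring_scope.

(* The torus (R / L Z)^d is represented by its universal cover 'rV[R]_d and the
   fundamental cell [0, L[^d: functions on the torus are L-periodic functions
   on 'rV[R]_d, and Borel measures on the torus are Borel measures on 'rV[R]_d
   carried by the cell. *)

Section borel_rV.
Context {R : realType} {n : nat}.

Let B := <<s (@open 'rV[R]_n) >>.

Let B0 : B set0. Proof. exact: sigma_algebra0. Qed.

Let BC A : B A -> B (~` A). Proof. exact: sigma_algebraC. Qed.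

Let Bbigcup (F : (set 'rV[R]_n)^nat) : (forall i, B (F i)) -> B (\bigcup_i F i).
Proof. exact: sigma_algebra_bigcup. Qed.

HB.instance Definition _ := @isMeasurable.Build
  (sigma_display (@open 'rV[R]_n)) 'rV[R]_n B B0 BC Bbigcup.

End borel_rV.

Lemma measurable_fun_rV {d} {T : measurableType d} {R : realType} {n : nat}
    (f : T -> 'rV[R]_n) :
  (forall i, measurable_fun [set: T] (fun x => f x ord0 i)) ->
  measurable_fun [set: T] f.
Proof.
move=> mf; apply: (measurability (@open 'rV[R]_n)) => //.
move=> _ [U oU <-]; rewrite setTI.
pose box (qr : 'rV[rat]_n * 'rV[rat]_n) : set 'rV[R]_n :=
  [set x | forall i, x ord0 i \in `]ratr (qr.1 ord0 i), ratr (qr.2 ord0 i)[].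
have mbox qr : measurable (f @^-1` box qr).
  have -> : f @^-1` box qr = \bigcap_(i in [set: 'I_n])
      ((fun x => f x ord0 i) @^-1`
        [set` `]ratr (qr.1 ord0 i), (ratr (qr.2 ord0 i) : R)[]).
    by apply/seteqP; split=> [x bx i _|x bx i]; [exact: bx|exact: (bx i I)].
  apply: fin_bigcap_measurable => // i _.
  by rewrite -[X in measurable X]setTI; apply: mf.
pose F qr : set T := if `[< box qr `<=` U >] then f @^-1` box qr else set0.
rewrite (_ : f @^-1` U = \bigcup_qr F qr).
  apply: countable_bigcupT_measurable => // qr.
  by rewrite /F; case: ifPn.
apply/seteqP; split=> [x Ux|x [qr _]]; last first.
  by rewrite /F; case: ifPn => // /asboolP bU fx; exact: bU.
have /nbhs_ballP[e /= e0 eU] : nbhs (f x) U by exact: open_nbhs_nbhs.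
have lo i : {q : rat | ratr q \in `](f x ord0 i - e), (f x ord0 i)[}.
  by apply/cid/rat_in_itvoo; rewrite ltrBlDr ltrDl.
have hi i : {q : rat | ratr q \in `](f x ord0 i), (f x ord0 i + e)[}.
  by apply/cid/rat_in_itvoo; rewrite ltrDl.
exists (\row_i sval (lo i), \row_i sval (hi i)) => //.
rewrite /F ifT.
  move=> i /=; rewrite !mxE.
  case: (lo i) (hi i) => [q /= +] [r /= +]; rewrite !in_itv/=.
  by move=> /andP[_ ->] /andP[-> _].
apply/asboolP => y yb; apply: eU; split=> // i j; rewrite (ord1 i).
have := yb j; rewrite /= !mxE.
case: (lo j) (hi j) => [q /= +] [r /= +].
rewrite !in_itv/= => /andP[q1 q2] /andP[r1 r2] /andP[y1 y2].
by rewrite /ball/= ltr_norml; lra.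
Qed.

Lemma continuous_measurable_rV {R : realType} {n : nat} (f : 'rV[R]_n -> R) :
  continuous f -> measurable_fun [set: 'rV[R]_n] f.
Proof.
move=> /continuousP cf.
apply: (measurability _ (measurable_realfun.RGenOpens.measurableE R)).
move=> _ [_ [a [b ->] <-]].
rewrite setTI; apply: sub_sigma_algebra; apply: cf; exact: interval_open.
Qed.

Lemma measurable_rV_cons {R : realType} {n : nat} :
  measurable_fun [set: measurableTypeR R * 'rV[R]_n]
    (fun p => row_mx p.1%:M p.2 : 'rV[R]_n.+1).
Proof.
apply: measurable_fun_rV => i.
case: (split_ordP (i : 'I_(1 + n))) => j ->.
  rewrite (_ : (fun _ => _) = fst) ?measurable_fst//.
  apply/funext => p; apply: etrans (row_mxEl p.1%:M p.2 ord0 j) _.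
  by rewrite (ord1 j) mxE eqxx.
rewrite (_ : (fun _ => _) = (fun v : 'rV[R]_n => v ord0 j) \o snd); last first.
  by apply/funext => p; exact: (row_mxEr p.1%:M p.2 ord0 j).
apply: measurableT_comp => //; apply: continuous_measurable_rV.
exact: coord_continuous.
Qed.

Section torus_measure.
Context {R : realType}.
Variable L : R.

Let cell1_fin :
  (@lebesgue_measure R [set` `[0%R, L[] < +oo)%E.
Proof.
by rewrite lebesgue_measure_itv/=; case: ifP => // _; rewrite -EFinD ltry.
Qed.

Definition circle_measure :
    {finite_measure set (measurableTypeR R) -> \bar R} :=
  mfrestr (measurable_itv `[0%R, L[ : measurable (_ : set (measurableTypeR R)))
    cell1_fin.

Section cons.
Context {n : nat}.
Variable mu : {finite_measure set 'rV[R]_n -> \bar R}.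

Definition cons_measure : set 'rV[R]_n.+1 -> \bar R :=
  pushforward (circle_measure \x mu)%E
    (fun p => row_mx p.1%:M p.2 : 'rV[R]_n.+1).

Let cons_measure0 : cons_measure set0 = 0%E.
Proof. by apply: measure0; exact: measurable_rV_cons. Qed.

Let cons_measure_ge0 A : (0 <= cons_measure A)%E.
Proof. by apply: measure_ge0; exact: measurable_rV_cons. Qed.

Let cons_measure_sigma_additive : semi_sigma_additive cons_measure.
Proof.
by apply: measure_semi_sigma_additive; exact: measurable_rV_cons.
Qed.

HB.instance Definition _ := isMeasure.Build _ _ _ cons_measure
  cons_measure0 cons_measure_ge0 cons_measure_sigma_additive.

Lemma cons_measureT :
  cons_measure setT = (circle_measure setT * mu setT)%E.
Proof. by rewrite -product_measure1E// setXTT. Qed.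

Let cons_measure_fin : fin_num_fun cons_measure.
Proof.
apply: lty_fin_num_fun.
suff: (circle_measure setT * mu setT < +oo)%E by rewrite -cons_measureT.
by rewrite lte_mul_pinfty// -?ge0_fin_numE// fin_num_measure.
Qed.

HB.instance Definition _ := Measure_isFinite.Build _ _ _ cons_measure
  cons_measure_fin.

End cons.

(* n-fold product of circle_measure, transported to 'rV[R]_n: the Lebesgue
   measure on the cell [0, L[^n *)
Fixpoint torus_measure (n : nat) : {finite_measure set 'rV[R]_n -> \bar R} :=
  match n with
  | 0 => \d_(0 : 'rV[R]_0)
  | n'.+1 => cons_measure (torus_measure n')
  end.

Lemma torus_measureT (n : nat) : 0 <= L ->
  torus_measure n setT = (L ^+ n)%:E.
Proof.
move=> L0; elim: n => [|n IHn] /=; first by rewrite diracT.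
rewrite cons_measureT IHn exprS EFinM; congr (_ * _)%E.
rewrite /circle_measure/= /mfrestr /mrestr setTI lebesgue_measure_itv/= lte_fin.
by case: ltgtP L0 => // [_|<-] _; rewrite ?sube0 ?oppr0 ?addr0//.
Qed.

End torus_measure.

Section torus_functions.
Context {R : realType} {d : nat}.
Variable L : R.
Implicit Types (f g phi rho : 'rV[R]_d -> R) (G : 'I_d -> 'rV[R]_d -> R).

Local Notation vol := (torus_measure L d).

Definition torus_periodic f := forall i x, f (x + L *: delta_mx ord0 i) = f x.

Definition partial_derive (i : 'I_d) f : 'rV[R]_d -> R :=
  fun x => 'D_(delta_mx ord0 i) f x.

Fixpoint Ck (k : nat) f : Prop :=
  continuous f /\
  if k is k'.+1 then
    forall i, (forall x, derivable f x (delta_mx ord0 i)) /\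
      Ck k' (partial_derive i f)
  else True.

Definition flip_coord (i : 'I_d) (x : 'rV[R]_d) : 'rV[R]_d :=
  \row_j (if j == i then - x ord0 j else x ord0 j).

Definition coordinatewise_even f := forall i x, f (flip_coord i x) = f x.

Definition test_function phi := torus_periodic phi /\ forall k, Ck k phi.

Definition weak_gradient f G := forall i phi, test_function phi ->
  \int[vol]_x (f x * partial_derive i phi x) = - \int[vol]_x (G i x * phi x).

Definition H1_with_gradient f G :=
  [/\ torus_periodic f, f \in Lfun vol 2%:E, forall i, torus_periodic (G i),
      forall i, G i \in Lfun vol 2%:E & weak_gradient f G].

Definition convolution f g : 'rV[R]_d -> R :=
  fun x => \int[vol]_y (f (x - y) * g y).

Definition probability_density rho :=
  [/\ torus_periodic rho, measurable_fun setT rho, forall x, 0 <= rho x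
    & (\int[vol]_x (rho x)%:E = 1)%E].

Definition stationary_solution (W : 'rV[R]_d -> R) (m beta : R) rho :=
  [/\ probability_density rho, rho \in Lfun vol m%:E,
      exists M, forall x, `|rho x| <= M
    & exists2 G, H1_with_gradient (fun x => rho x `^ m) G &
        forall phi Phi, H1_with_gradient phi Phi ->
          \int[vol]_x (\sum_(i < d)
            (beta^-1 * G i x + rho x * partial_derive i (convolution W rho) x)
            * Phi i x) = 0].

Definition torus_cell : set 'rV[R]_d := [set x | forall i, 0 <= x ord0 i < L].

Definition torus_probability (mu : probability 'rV[R]_d R) :=
  mu torus_cell = 1%E.

(* the Radon-Nikodym derivative, which is nonnegative only almost everywhere *)
Definition torus_density (mu : probability 'rV[R]_d R) : 'rV[R]_d -> R :=
  fine \o Radon_Nikodym (charge_of_finite_measure mu) vol.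

Definition interaction_integrand (W : 'rV[R]_d -> R) rho
    (z : 'rV[R]_d * 'rV[R]_d) : R :=
  W (z.1 - z.2) * rho z.1 * rho z.2.

Definition free_energy (W : 'rV[R]_d -> R) (m beta : R)
    (mu : probability 'rV[R]_d R) : \bar R :=
  let rho := torus_density mu in
  if `[< [/\ mu `<< vol,
             vol.-integrable setT (EFin \o (fun x => rho x `^ m))
           & (vol \x vol)%E.-integrable setT
               (EFin \o interaction_integrand W rho)] >]
  then (beta^-1 / (m - 1) * \int[vol]_x (rho x `^ m) - beta^-1 / (m - 1)
        + 2^-1 * \int[(vol \x vol)%E]_z interaction_integrand W rho z)%:E
  else +oo%E.

Definition free_energy_minimiser (W : 'rV[R]_d -> R) (m beta : R)
    (mu : probability 'rV[R]_d R) :=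
  torus_probability mu /\
  forall nu, torus_probability nu ->
    (free_energy W m beta mu <= free_energy W m beta nu)%E.

End torus_functions.

Definition rho_infty {R : realType} (d : nat) (L : R) : R := (L ^+ d)^-1.

(* Main.v *)
Require Import Defs.
From mathcomp Require Import all_boot all_order all_algebra lra ring.
From mathcomp Require Import all_classical all_reals all_analysis measurable_realfun.
Import numFieldNormedType.Exports.
Import Order.TTheory GRing.Theory Num.Theory.
Local Open Scope classical_set_scope.
Local Open Scope ring_scope.

Set Implicit Arguments.
Unset Strict Implicit.
Unset Printing Implicit Defensive.

(** For small beta the diffusion, of size 1 / beta, dominates the drift, which is
    controlled by W alone.  Write a for the constant density, s = rho - a for the
    deviation, and use throughout that W averages to zero and is even, so that
    convolving W with rho or with s gives the same function.

    Stationary solutions.  Let G be the weak gradient of u = rho^m and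
    D = int s^2.  Testing the equation against u itself and completing the square
    gives int |G|^2 <= beta^2 int rho^2 |grad (W * s)|^2.  When the partial
    derivatives of W are bounded by M, those of W * rho are at most M, and by
    Jensen their squares are at most M^2 L^d D; as int rho^2 = D + a, using the
    first bound when D > a and the second one when D <= a yields
    int |G|^2 <= C beta^2 D with no a priori bound on rho (stationary_estimate).  Conversely r |-> r^m is
    strongly monotone at a, so a^(m-1) D <= int u s, and as s has mean zero a
    Poincare inequality bounds the right-hand side by (int |G|^2)^(1/2) D^(1/2)
    (pairing_bound).  Together D <= C beta^2 D, so D = 0 for small beta
    (stationary_unique).

    The Poincare inequality is needed only in its dual form, for u paired with a
    bounded function of mean zero.  Such a pairing is an average over
    translations h of int (u(x + h) - u(x)) s(x) dx, and an increment of u along a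
    coordinate axis is the integral of the corresponding G i along a segment
    (weak_increment).  For smooth test functions in place of s that is the
    definition of the weak gradient and Fubini; the passage to bounded functions
    is the fundamental lemma of the calculus of variations
    (fundamental_lemma), for which explicit smooth periodic functions converging
    to indicators of orthants are enough.

    Minimisers.  Strict convexity of r |-> r^m makes the internal energy exceed
    its value at a by at least c (int |s|)^2, a Pinsker inequality
    (pressure_gap), whereas the interaction energy is at most
    sup |W| (int |s|)^2 in absolute value (interaction_bound).  The factor 1 / beta
    in front of the first makes the total strictly larger than the energy of the
    uniform probability unless rho = a almost everywhere (free_energy_gap). *)

(** * Real-valued integrals against a finite measure *)

Section real_integrals.
Context {d} {T : measurableType d} {R : realType}.
Variable mu : {finite_measure set T -> \bar R}.
Implicit Types f g : T -> R.

(** All functions below are real-valued; this keeps the coercion to extended reals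
    out of the integrability hypotheses. *)
Definition intg f := mu.-integrable setT (EFin \o f).

Definition bounded_measurable f :=
  measurable_fun setT f /\ exists M, forall x, `|f x| <= M.

Lemma bounded_measurable_cst (c : R) : bounded_measurable (fun=> c).
Proof. by split => //; exists `|c|. Qed.

Lemma bounded_measurableM f g : bounded_measurable f -> bounded_measurable g ->
  bounded_measurable (fun x => f x * g x).
Proof.
move=> [mf [M fM]] [mg [N gN]]; split; first exact: measurable_funM.
by exists (M * N) => x; rewrite normrM ler_pM.
Qed.

Lemma bounded_measurableB f g : bounded_measurable f -> bounded_measurable g ->
  bounded_measurable (fun x => f x - g x).
Proof.
move=> [mf [M fM]] [mg [N gN]]; split; first exact: measurable_funB.
by exists (M + N) => x; rewrite (le_trans (ler_normB _ _))// lerD.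
Qed.

Lemma bounded_measurable_norm f : bounded_measurable f ->
  bounded_measurable (fun x => `|f x|).
Proof.
move=> [mf [M fM]]; split; first exact: measurableT_comp.
by exists M => x; rewrite normr_id.
Qed.

Lemma intg_measurable f : intg f -> measurable_fun setT f.
Proof. by move=> /measurable_int/measurable_EFinP. Qed.

Lemma intgD f g : intg f -> intg g -> intg (fun x => f x + g x).
Proof. exact: integrableD. Qed.

Lemma intgB f g : intg f -> intg g -> intg (fun x => f x - g x).
Proof. exact: integrableB. Qed.

Lemma intgZ (k : R) f : intg f -> intg (fun x => k * f x).
Proof. exact: integrableZl. Qed.

Lemma intg_norm f : intg f -> intg (fun x => `|f x|).
Proof. exact: integrable_norm. Qed.

Lemma intg_sum n (F : 'I_n -> T -> R) : (forall i, intg (F i)) ->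
  intg (fun x => \sum_(i < n) F i x).
Proof.
move=> Fi; rewrite /intg.
rewrite (_ : EFin \o _ = (fun x => \sum_(i < n) (F i x)%:E)%E).
  by apply: integrable_sum => // i _; exact: Fi.
by apply/funext => x /=; rewrite sumEFin.
Qed.

Lemma intg_le f g : measurable_fun setT f -> (forall x, `|f x| <= g x) ->
  intg g -> intg f.
Proof.
move=> mf fg; apply: le_integrable => //; first exact/measurable_EFinP.
by move=> x _ /=; rewrite lee_fin (le_trans (fg x))// ler_norm.
Qed.

Lemma intg_cst c : intg (fun=> c).
Proof. exact: finite_measure_integrable_cst. Qed.

Lemma bounded_measurable_intg f : bounded_measurable f -> intg f.
Proof. by move=> [mf [M fM]]; apply: intg_le mf fM (intg_cst M). Qed.

Lemma intg_mul f g : intg f -> bounded_measurable g -> intg (fun x => f x * g x).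
Proof.
move=> fi [mg [M gM]]; apply: (@intg_le _ (fun x => M * `|f x|)).
- by apply: measurable_funM => //; exact: intg_measurable.
- by move=> x; rewrite normrM mulrC ler_wpM2r.
- exact/intgZ/intg_norm.
Qed.

(** Cauchy-Schwarz in its qualitative form: |f g| <= f^2 + g^2. *)
Lemma intg_mul_sqr f g : measurable_fun setT f -> measurable_fun setT g ->
  intg (fun x => f x ^+ 2) -> intg (fun x => g x ^+ 2) ->
  intg (fun x => f x * g x).
Proof.
move=> mf mg f2 g2; apply: (@intg_le _ (fun x => f x ^+ 2 + g x ^+ 2)).
- exact: measurable_funM.
- move=> x; rewrite normrM -(real_normK (num_real (f x))) -(real_normK (num_real (g x))).
  have := sqr_ge0 (`|f x| - `|g x|); have := mulr_ge0 (normr_ge0 (f x)) (normr_ge0 (g x)).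
  lra.
- exact: intgD.
Qed.

Lemma RintegralN f : intg f -> \int[mu]_x (- f x) = - \int[mu]_x f x.
Proof.
by move=> fi; under eq_Rintegral do rewrite -mulN1r; rewrite RintegralZl// mulN1r.
Qed.

Lemma ae_eq_Rintegral f g : intg f -> measurable_fun setT g -> ae_eq mu setT f g ->
  \int[mu]_x f x = \int[mu]_x g x.
Proof.
move=> fi mg fg; congr fine; apply: ae_eq_integral => //.
- exact/measurable_EFinP/intg_measurable.
- exact/measurable_EFinP.
- by apply: filterS fg => x fgx Dx; rewrite fgx.
Qed.

Lemma Rintegral_sum n (F : 'I_n -> T -> R) : (forall i, intg (F i)) ->
  \int[mu]_x (\sum_(i < n) F i x) = \sum_(i < n) \int[mu]_x F i x.
Proof.
elim: n F => [|n IHn] F Fi.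
  under eq_Rintegral do rewrite big_ord0.
  by rewrite big_ord0 Rintegral_cst// mul0r.
under eq_Rintegral do rewrite big_ord_recl.
rewrite RintegralD//; first by rewrite IHn// big_ord_recl.
- exact: Fi.
- by apply: (@intg_sum _ (fun i => F (lift ord0 i))) => i; exact: Fi.
Qed.

(** Replacing g by max f g, which equals g almost everywhere, reduces this to
    the pointwise comparison. *)
Lemma intg_ae_le f g : intg f -> intg g -> {ae mu, forall x, f x <= g x} ->
  \int[mu]_x f x <= \int[mu]_x g x.
Proof.
move=> fi gi fg.
have mM : measurable_fun setT (fun x => Order.max (f x) (g x)).
  by apply: measurable_maxr; exact: intg_measurable.
have Mi : intg (fun x => Order.max (f x) (g x)).
  apply: (@intg_le _ (fun x => `|f x| + `|g x|)) => //.
    by move=> x; have [_|_] := leP (f x) (g x); rewrite ?lerDl ?lerDr.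
  by apply: intgD; exact: intg_norm.
rewrite [leRHS](@ae_eq_Rintegral _ (fun x => Order.max (f x) (g x)))//.
  by apply: le_Rintegral => // x _; rewrite le_max lexx.
by apply: filterS fg => x fgx _; rewrite max_r.
Qed.

Lemma Rintegral_ge0_eq0 f : intg f -> (forall x, 0 <= f x) ->
  \int[mu]_x f x <= 0 -> ae_eq mu setT f (cst 0).
Proof.
move=> fi f0 I0.
have /ae_eq_integral_abs : (\int[mu]_x `|(f x)%:E| = 0)%E.
  apply/eqP; rewrite eq_le integral_ge0 ?andbT//.
  under eq_integral do rewrite gee0_abs ?lee_fin//.
  rewrite -[leLHS]fineK ?lee_fin//.
  exact: integrable_fin_num.
move=> /(_ measurableT (measurable_int _ fi)).
by apply: filterS => x /= H Dx; have [] := H Dx.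
Qed.

(** The weight l is left free: a suitable choice absorbs one of the two terms and
    makes square roots unnecessary. *)
Lemma young (l a b : R) : 0 < l -> `|a * b| <= l / 2 * a ^+ 2 + b ^+ 2 / (2 * l).
Proof.
move=> l0.
rewrite normrM -(real_normK (num_real a)) -(real_normK (num_real b)).
rewrite -subr_ge0.
have -> : l / 2 * `|a| ^+ 2 + `|b| ^+ 2 / (2 * l) - `|a| * `|b| =
   (l * `|a| - `|b|) ^+ 2 / (2 * l).
  by field; rewrite gt_eqF.
by rewrite divr_ge0 ?sqr_ge0// mulr_ge0// ltW.
Qed.

Lemma Rintegral_young (l : R) f g : 0 < l ->
  measurable_fun setT f -> measurable_fun setT g ->
  intg (fun x => f x ^+ 2) -> intg (fun x => g x ^+ 2) ->
  `|\int[mu]_x (f x * g x)| <=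
    l / 2 * \int[mu]_x (f x ^+ 2) + (\int[mu]_x (g x ^+ 2)) / (2 * l).
Proof.
move=> l0 mf mg f2 g2.
have fgi := intg_mul_sqr mf mg f2 g2.
rewrite (le_trans (le_normr_Rintegral _ fgi))// -RintegralZl// -RintegralZr//.
have g2' : intg (fun x => g x ^+ 2 / (2 * l)).
  by under eq_fun do rewrite mulrC; exact: intgZ.
rewrite -RintegralD//; last exact: intgZ.
apply: le_Rintegral => //.
- exact: intg_norm.
- by apply: intgD => //; exact: intgZ.
- by move=> x _; exact: young.
Qed.

End real_integrals.

(** * Fubini for real-valued integrals *)

(** Partial integrals of an integrable function may be infinite on a null set;
    taking fine there changes neither integrability nor the integral. *)
Lemma intg_fine {d} {T : measurableType d} {R : realType}
    (mu : {finite_measure set T -> \bar R}) (e : T -> \bar R) :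
  mu.-integrable setT e ->
  intg mu (fun x => fine (e x)) /\ \int[mu]_x fine (e x) = fine (\int[mu]_x e x)%E.
Proof.
move=> ei.
have ae : ae_eq mu setT (fun x => (fine (e x))%:E) e.
  by apply: filterS (integrable_ae measurableT ei) => x ex _; rewrite fineK// ex.
have me := measurable_int _ ei.
have mm : measurable_fun setT (fun x => (fine (e x))%:E).
  exact/measurable_EFinP/(measurableT_comp (fine_measurable measurableT)).
split.
  apply/integrableP; split => //.
  move/integrableP : ei => [_]; apply: le_lt_trans.
  rewrite (@ae_eq_integral _ _ _ mu _ (abse \o e))//.
  - exact: measurableT_comp.
  - exact: measurableT_comp.
  - by apply: filterS ae => x /= H Dx; rewrite -H.
by congr fine; exact: ae_eq_integral.
Qed.

Lemma intg2_swap {d1 d2} {T1 : measurableType d1} {T2 : measurableType d2}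
    {R : realType} (mu : {finite_measure set T1 -> \bar R})
    (nu : {finite_measure set T2 -> \bar R}) (F : T1 * T2 -> R) :
  (mu \x nu)%E.-integrable setT (EFin \o F) ->
  (nu \x mu)%E.-integrable setT (EFin \o (fun z : T2 * T1 => F (z.2, z.1))).
Proof.
move=> Fi; have mF := measurable_int _ Fi.
apply/integrable12ltyP; first by apply: (measurableT_comp mF); exact: measurable_fun_pair.
exact: (integrable21ltyP _ _ mF).1 Fi.
Qed.

Section fubini_real.
Context {d1 d2} {T1 : measurableType d1} {T2 : measurableType d2} {R : realType}.
Variables (mu : {finite_measure set T1 -> \bar R}).
Variables (nu : {finite_measure set T2 -> \bar R}).
Implicit Types F : T1 * T2 -> R.

Definition intg2 F := (mu \x nu)%E.-integrable setT (EFin \o F).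

Lemma intg2_dominated1 F (h : T1 -> R) : measurable_fun setT F ->
  (forall z, `|F z| <= h z.1) -> intg mu h -> intg2 F.
Proof.
move=> mF Fh hi.
have mh : measurable_fun setT (fun z : T1 * T2 => h z.1).
  exact: (measurableT_comp (intg_measurable hi) measurable_fst).
apply: (@le_integrable _ _ _ _ _ measurableT _ (EFin \o (fun z : T1 * T2 => h z.1))).
- exact/measurable_EFinP.
- by move=> z _ /=; rewrite lee_fin (le_trans (Fh z))// ler_norm.
- apply/integrable12ltyP; first exact/measurable_EFinP.
  rewrite /=; under eq_integral do rewrite integral_cst//.
  rewrite ge0_integralZr//.
  + rewrite lte_mul_pinfty//.
    * exact: integral_ge0.
    * rewrite ge0_fin_numE; last exact: integral_ge0.
      by have /integrableP[] := hi.
    * by rewrite ltey_eq fin_num_measure.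
  + apply/measurable_EFinP; apply: measurableT_comp => //.
    exact: (intg_measurable hi).
Qed.

Lemma intg2_bounded F : measurable_fun setT F ->
  (exists M, forall z, `|F z| <= M) -> intg2 F.
Proof.
by move=> mF [M FM]; apply: (@intg2_dominated1 F (fun=> M)) => //; exact: intg_cst.
Qed.

(** Tonelli: finiteness of one iterated integral of |F| is enough. *)
Lemma intg2_iterated F (h : T1 -> R) : measurable_fun setT F -> intg mu h ->
  (forall x, (\int[nu]_y `|F (x, y)|%:E <= (h x)%:E)%E) -> intg2 F.
Proof.
move=> mF hi Fh; apply/integrable12ltyP; first exact/measurable_EFinP.
have mabs : measurable_fun setT (fun z => `|F z|%:E).
  by apply/measurable_EFinP; exact: measurableT_comp.
apply: (@le_lt_trans _ _ (\int[mu]_x (h x)%:E)%E); last exact: (integrable_lty measurableT hi).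
apply: ge0_le_integral => //.
- by move=> x _; exact: integral_ge0.
- by have := measurable_fun_fubini_tonelli_F _ mabs; apply.
- exact: measurable_int hi.
- by move=> x _; exact: Fh.
Qed.

Lemma Rfubini F : intg2 F ->
  [/\ intg mu (fun x => \int[nu]_y F (x, y)),
     intg nu (fun y => \int[mu]_x F (x, y)),
     \int[mu]_x \int[nu]_y F (x, y) = \int[(mu \x nu)%E]_z F z &
     \int[mu]_x \int[nu]_y F (x, y) = \int[nu]_y \int[mu]_x F (x, y)].
Proof.
move=> Fi.
have [i1 e1] := intg_fine (integrable_fubini_F Fi).
have [i2 e2] := intg_fine (integrable_fubini_F (intg2_swap Fi)).
split => //.
- by apply: etrans e1 _; congr fine; exact: integral12_prod_meas1.
- by apply: etrans e1 (etrans _ (esym e2)); congr fine; exact: Fubini.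
Qed.

End fubini_real.

(** * Translation invariance on the torus *)

Section circle.
Context {R : realType}.
Implicit Types (L s a b : R).

Local Notation leb := (@lebesgue_measure R).

Lemma measurable_shift s : measurable_fun [set: R] (fun t : R => t + s).
Proof. exact: measurable_funD. Qed.

(** Lebesgue measure is its own image under a translation, because the two
    agree on intervals. *)
Lemma ge0_integral_itv_shift s a b (g : R -> \bar R) :
  measurable_fun setT g -> (forall t, 0 <= g t)%E ->
  (\int[leb]_(t in `[a, b[) g (t + s)%R = \int[leb]_(t in `[(a + s)%R, (b + s)%R[) g t)%E.
Proof.
move=> mg g0.
have ms : measurable_fun setT ((fun t => t + s) : measurableTypeR R -> measurableTypeR R).
  exact: measurable_shift.
pose m := measure_function_pushforward__canonical__measure_function_Measure leb ms.
have shiftE (A : set (measurableTypeR R)) : measurable A -> leb A = m A.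
  move=> mA; apply: (@lebesgue_measure_unique _ m) => // X [[x y] _ <-] /=.
  rewrite /m/= /pushforward /=.
  have -> : (fun t => t + s) @^-1` `]x, y] = `]x - s, y - s]%classic.
    by apply/seteqP; split => t /=; rewrite !in_itv/= ltrBlDr lerBrDr.
  by rewrite !lebesgue_measure_itv/= !lte_fin ltrD2r -!EFinD; case: ifP => // _; congr (_%:E); ring.
rewrite [RHS](eq_measure_integral m); last first.
  by move=> A mA _; exact: shiftE.
rewrite /m/= ge0_integral_pushforward//; last exact: measurable_funTS.
have -> // : (fun t => t + s) @^-1` `[a + s, b + s[ = `[a, b[%classic.
by apply/seteqP; split => t /=; rewrite !in_itv/= lerD2r ltrD2r.
Qed.

Lemma circle_measureT L : 0 <= L -> fine (circle_measure L setT) = L.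
Proof.
rewrite /circle_measure/= /mfrestr/mrestr setTI lebesgue_measure_itv/= lte_fin.
by rewrite le_eqVlt => /predU1P[<-|L0]; rewrite ?ltxx// L0 /= oppr0 addr0.
Qed.

(** The circle measure is carried by the interval, so both sides agree up to
    the null set outside of it. *)
Lemma circle_integralE L (g : R -> \bar R) : measurable_fun setT g ->
  (\int[circle_measure L]_t g t = \int[leb]_(t in `[0%R, L[) g t)%E.
Proof.
move=> mg.
rewrite [RHS](eq_measure_integral (circle_measure L))/=; last first.
  by move=> A mA AI; rewrite /circle_measure/= /mfrestr/mrestr setIidl.
rewrite [RHS]integral_mkcond; apply: ae_eq_integral => //.
  by apply/(measurable_restrictT _ _).1 => //; exact: measurable_funTS.
exists (~` `[0, L[%classic); split.
- exact: measurableC.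
- by rewrite /circle_measure/= /mfrestr/mrestr setICl measure0.
- move=> t /= /not_implyP[_]; apply: contra_not => tL.
  by rewrite patchE mem_set.
Qed.

(** Modulo periods the shift is by some r in [0, L[.  The shifted interval
    [r, L + r[ exceeds [0, L[ by [L, L + r[ and misses [0, r[; periodicity
    matches these two pieces. *)
Lemma circle_shift L s (g : R -> \bar R) : 0 < L ->
  measurable_fun setT g -> (forall t, 0 <= g t)%E ->
  (forall t, g (t + L) = g t) ->
  (\int[circle_measure L]_t g (t + s)%R = \int[circle_measure L]_t g t)%E.
Proof.
move=> L0 mg g0 gL.
have gLn n t : g (t + L *+ n) = g t.
  by elim: n => [|n IH]; rewrite ?mulr0n ?addr0// mulrS addrA -addrA (addrC L) addrA gL.
have gLz (k : int) t : g (t + L *~ k) = g t.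
  case: k => n; first exact: gLn.
  by rewrite NegzE mulrNz -(gLn n.+1) addrNK.
pose r := s - L *~ Num.floor (s / L).
have r0 : 0 <= r.
  by rewrite subr_ge0 -mulrzr mulrC -ler_pdivlMr// floor_le.
have rL : r < L.
  rewrite ltrBlDr -mulrzr -{1}(mulr1 L) -mulrDr mulrC -ltr_pdivrMr//.
  by rewrite -(intrD _ 1) addrC floorD1_gt.
have sE t : g (t + s) = g (t + r).
  by rewrite -(gLz (Num.floor (s / L)) (t + r)) -addrA subrK.
under eq_integral do rewrite sE.
have mgr : measurable_fun [set: R] (fun t : R => g (t + r)).
  by apply: measurableT_comp => //; exact: measurable_shift.
rewrite !circle_integralE// ge0_integral_itv_shift// add0r.
have split_int a b c : a <= b -> b <= c ->
    (\int[leb]_(t in `[a, c[) g t =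
     \int[leb]_(t in `[a, b[) g t + \int[leb]_(t in `[b, c[) g t)%E.
  move=> ab bc; rewrite (@itv_bndbnd_setU _ _ (BLeft a) (BLeft b) (BLeft c)) ?bnd_simp//.
  rewrite ge0_integral_setU//; first exact: measurable_funTS.
  by apply/lt_disjoint => x y /= /[!in_itv]/= /andP[_ xb] /andP[yb _]; exact: lt_le_trans yb.
rewrite (split_int r L) ?(ltW rL) ?lerDl//.
rewrite (split_int 0 r L) ?(ltW rL)// addeC; congr (_ + _)%E.
under [RHS]eq_integral do rewrite -gL.
rewrite ge0_integral_itv_shift// ?add0r 1?(addrC r)//.
Qed.
End circle.

Section torus_integral.
Context {R : realType}.
Implicit Types (L : R).

Lemma measurable_coord n (i : 'I_n) :
  measurable_fun setT (fun x : 'rV[R]_n => x ord0 i).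
Proof. by apply: continuous_measurable_rV; exact: coord_continuous. Qed.

Lemma measurable_translation n (h : 'rV[R]_n) :
  measurable_fun setT (fun x : 'rV[R]_n => x + h).
Proof.
apply: measurable_fun_rV => i; under eq_fun do rewrite mxE.
by apply: measurable_funD => //; exact: measurable_coord.
Qed.

(** The recursion defining the torus measure, in the form used by inductions on
    the dimension. *)
Lemma ge0_torus_integralS L n (f : 'rV[R]_n.+1 -> \bar R) :
  measurable_fun setT f -> (forall x, 0 <= f x)%E ->
  (\int[torus_measure L n.+1]_x f x =
   \int[circle_measure L]_t \int[torus_measure L n]_x
     f (row_mx t%:M x : 'rV_(1 + n)))%E.
Proof.
move=> mf f0.
have mc := @measurable_rV_cons R n.
rewrite (ge0_integral_pushforward mc)//.
rewrite fubini_tonelli1//=; exact: measurableT_comp.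
Qed.

Lemma row_mx_coordl n (t : R) (x : 'rV[R]_n) :
  (row_mx t%:M x : 'rV[R]_n.+1) ord0 (lshift n (ord0 : 'I_1)) = t.
Proof. by apply: etrans (row_mxEl t%:M x ord0 ord0) _; rewrite mxE eqxx. Qed.

Lemma row_mx_coordr n (t : R) (x : 'rV[R]_n) i :
  (row_mx t%:M x : 'rV[R]_n.+1) ord0 (rshift 1 i) = x ord0 i.
Proof. exact: row_mxEr. Qed.

Lemma row_mx_shiftr L n (t : R) (x : 'rV[R]_n) (i : 'I_n) :
  row_mx t%:M (x + L *: delta_mx ord0 i) =
  (row_mx t%:M x : 'rV[R]_n.+1) + L *: delta_mx ord0 (rshift 1 i).
Proof.
apply: esym; apply: etrans (_ : row_mx t%:M x + L *: row_mx 0 (delta_mx ord0 i) = _).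
  by congr (_ + L *: _); exact: delta_mx_rshift.
by rewrite scale_row_mx scaler0 add_row_mx addr0.
Qed.

Lemma row_mx_shiftl L n (t : R) (x : 'rV[R]_n) :
  row_mx (t + L)%:M x =
  (row_mx t%:M x : 'rV[R]_n.+1) + L *: delta_mx ord0 (lshift n (ord0 : 'I_1)).
Proof.
apply: esym; apply: etrans (_ : row_mx t%:M x + L *: row_mx (delta_mx ord0 ord0) 0 = _).
  by congr (_ + L *: _); exact: delta_mx_lshift.
rewrite scale_row_mx scaler0 add_row_mx addr0; congr row_mx.
by rewrite [delta_mx _ _]mx11_scalar mxE eqxx/= scale_scalar_mx mulr1 -raddfD.
Qed.

(** Induction on the dimension: shift the last coordinates under the integral in
    the first one by induction, then the first one on the circle. *)
Lemma ge0_torus_shift L n (f : 'rV[R]_n -> \bar R) (h : 'rV[R]_n) : 0 < L ->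
  measurable_fun setT f -> (forall x, 0 <= f x)%E ->
  (forall i x, f (x + L *: delta_mx ord0 i) = f x) ->
  (\int[torus_measure L n]_x f (x + h)%R = \int[torus_measure L n]_x f x)%E.
Proof.
move=> L0; elim: n f h => [|n IHn] f h mf f0 fL.
  by apply: eq_integral => x _; congr f; apply/rowP; case.
have mfh : measurable_fun setT (fun x : 'rV[R]_n.+1 => f (x + h)).
  exact: (measurableT_comp mf (measurable_translation h)).
have E1 := ge0_torus_integralS L mf f0.
have E2 := ge0_torus_integralS L mfh (fun x => f0 _).
refine (etrans E2 (etrans _ (esym E1))) => {E1 E2}.
have mcons := measurableT_comp mf (@measurable_rV_cons R n).
pose g t := (\int[torus_measure L n]_x f (row_mx t%:M x : 'rV_(1 + n)))%E.
have mg : measurable_fun [set: measurableTypeR R] g.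
  exact: (@measurable_fun_fubini_tonelli_F _ _ _ _ R (torus_measure L n) _ mcons (fun z => f0 _)).
have g0 t : (0 <= g t)%E by apply: integral_ge0.
pose h1 := lsubmx (h : 'rV_(1 + n)); pose h2 := rsubmx (h : 'rV_(1 + n)).
have consD t x : (row_mx t%:M x : 'rV_(1 + n)) + h =
    row_mx (t + h1 ord0 ord0)%:M (x + h2).
  rewrite -[X in _ + X](@hsubmxK _ 1 1 n) add_row_mx [lsubmx _]mx11_scalar.
  by rewrite -raddfD.
transitivity (\int[circle_measure L]_t g (t + h1 ord0 ord0)%R)%E.
  apply: eq_integral => t _; under eq_integral do rewrite consD.
  apply: (IHn (fun x => f (row_mx (t + h1 ord0 ord0)%:M x : 'rV_(1 + n)))).
  - exact: (measurableT_comp mcons (pair1_measurable _)).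
  - by [].
  - move=> i x; rewrite -[RHS](fL (rshift 1 i)); congr f.
    exact: row_mx_shiftr.
apply: circle_shift => // t.
apply: eq_integral => x _; rewrite -[RHS](fL (lshift n (ord0 : 'I_1))); congr f.
exact: row_mx_shiftl.
Qed.

Lemma torus_shift L n (f : 'rV[R]_n -> \bar R) (h : 'rV[R]_n) : 0 < L ->
  measurable_fun setT f ->
  (forall i x, f (x + L *: delta_mx ord0 i) = f x) ->
  (\int[torus_measure L n]_x f (x + h)%R = \int[torus_measure L n]_x f x)%E.
Proof.
move=> L0 mf fL; rewrite integralE [RHS]integralE; congr (_ - _)%E.
- have H : measurable_fun setT (f^\+)%E by exact: measurable_funepos.
  have H2 x : (0 <= f^\+ x)%E by [].
  have H3 i (x : 'rV[R]_n) : (f^\+ (x + L *: delta_mx ord0 i)%R = f^\+ x)%E by rewrite !funeposE fL.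
  by rewrite -(ge0_torus_shift h L0 H H2 H3); apply: eq_integral => x _; rewrite !funeposE.
- have H : measurable_fun setT (f^\-)%E by exact: measurable_funeneg.
  have H2 x : (0 <= f^\- x)%E by [].
  have H3 i (x : 'rV[R]_n) : (f^\- (x + L *: delta_mx ord0 i)%R = f^\- x)%E by rewrite !funenegE fL.
  by rewrite -(ge0_torus_shift h L0 H H2 H3); apply: eq_integral => x _; rewrite !funenegE.
Qed.

Lemma measurable_open_cell L n :
  measurable [set x : 'rV[R]_n | forall i, 0 < x ord0 i < L].
Proof.
rewrite (_ : [set _ | _] = \bigcap_(i in [set: 'I_n])
    ((fun x : 'rV[R]_n => x ord0 i) @^-1` `]0, L[%classic)).
  apply: fin_bigcap_measurable => // i _.
  by rewrite -[X in measurable X]setTI; apply: measurable_coord.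
by apply/seteqP; split => [x xL i _|x xL i]; [|have := xL i I]; rewrite /= in_itv/=.
Qed.

Lemma torus_measure_open_cell L n : 0 < L ->
  torus_measure L n [set x | forall i, 0 < x ord0 i < L] = (L ^+ n)%:E.
Proof.
move=> L0; elim: n => [|n IHn].
  by rewrite /= diracE mem_set ?expr0// => -[].
rewrite /= /cons_measure /pushforward /=.
rewrite (_ : _ @^-1` _ = `]0, L[%classic `*` [set x : 'rV[R]_n | forall i, 0 < x ord0 i < L]).
  rewrite product_measure1E//; last first.
    exact: measurable_open_cell.
  rewrite exprS EFinM; congr (_ * _)%E; last exact: IHn.
  rewrite /circle_measure/= /mfrestr /mrestr setIidl.
    by rewrite lebesgue_measure_itv/= lte_fin L0 sube0.
  by move=> t/=; rewrite !in_itv/= => /andP[/ltW -> ->].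
apply/seteqP; split => [[t x]/= tx|[t x]/= [tL xL] i].
  split; first by have := tx (lshift n (ord0 : 'I_1)); rewrite row_mx_coordl in_itv.
  by move=> i; have := tx (rshift 1 i); rewrite row_mx_coordr.
case: (split_ordP (i : 'I_(1 + n))) => j ->; last by rewrite row_mx_coordr.
by rewrite (ord1 j) row_mx_coordl; rewrite in_itv in tL.
Qed.

(** The faces of the cell are null because the open cell has full measure. *)
Lemma ae_open_cell L n : 0 < L ->
  {ae torus_measure L n, forall x : 'rV[R]_n, forall i, 0 < x ord0 i < L}.
Proof.
move=> L0.
have mA := @measurable_open_cell L n.
exists (~` [set x : 'rV[R]_n | forall i, 0 < x ord0 i < L]); split => //.
  exact: measurableC.
rewrite -setTD; apply: (etrans (measureD measurableT mA _)).
  by rewrite ltey_eq fin_num_measure.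
rewrite setTI [X in (X - _)%E]torus_measureT ?ltW//.
by rewrite [X in (_ - X)%E]torus_measure_open_cell// subee.
Qed.

End torus_integral.

Section torus_real.
Context {R : realType} {d : nat}.
Variable L : R.
Hypothesis L0 : 0 < L.
Implicit Types (f g : 'rV[R]_d -> R) (h : 'rV[R]_d).

Local Notation vol := (torus_measure L d).

Lemma rho_infty_gt0 : 0 < rho_infty d L.
Proof. by rewrite /rho_infty invr_gt0 exprn_gt0. Qed.

Lemma volT : fine (vol setT) = L ^+ d.
Proof. by rewrite torus_measureT// ltW. Qed.

Lemma rho_inftyM : rho_infty d L * L ^+ d = 1.
Proof. by rewrite /rho_infty mulVf// gt_eqF// exprn_gt0. Qed.

Lemma Rtorus_shift f h : measurable_fun setT f -> torus_periodic L f ->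
  \int[vol]_x f (x + h) = \int[vol]_x f x.
Proof.
move=> mf pf; rewrite /Rintegral; congr fine.
apply: (torus_shift (f := EFin \o f) h L0); first exact/measurable_EFinP.
by move=> i x /=; rewrite pf.
Qed.

Lemma measurable_shifted f h : measurable_fun setT f ->
  measurable_fun setT (fun x : 'rV[R]_d => f (x + h)).
Proof. by move=> mf; exact: (measurableT_comp mf (measurable_translation h)). Qed.

Lemma intg_torus_shift f h : intg vol f -> torus_periodic L f ->
  intg vol (fun x : 'rV[R]_d => f (x + h)).
Proof.
move=> /integrableP[mf fi] pf; apply/integrableP; split.
  exact: (measurableT_comp mf (measurable_translation h)).
rewrite (torus_shift (f := fun x => `|(f x)%:E|%E) h L0)//.
  exact: measurableT_comp.
by move=> i x /=; rewrite pf.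
Qed.

Lemma torus_periodic_shift f h : torus_periodic L f ->
  torus_periodic L (fun x : 'rV[R]_d => f (x + h)).
Proof. by move=> pf i x; rewrite addrAC pf. Qed.

Lemma bounded_measurable_shift f h : bounded_measurable f ->
  bounded_measurable (fun x : 'rV[R]_d => f (x + h)).
Proof. by move=> [mf [M fM]]; split; [exact: measurable_shifted|exists M]. Qed.

Lemma torus_periodic_int f (z : 'I_d -> int) (s : seq 'I_d) x :
  torus_periodic L f ->
  f (x + \sum_(i <- s) (L *~ z i) *: delta_mx ord0 i) = f x.
Proof.
move=> pf.
have pfn n i y : f (y + (L *+ n) *: delta_mx ord0 i) = f y.
  elim: n => [|n IHn]; first by rewrite mulr0n scale0r addr0.
  by rewrite mulrSr scalerDl addrA pf IHn.
have pfz k i y : f (y + (L *~ k) *: delta_mx ord0 i) = f y.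
  case: k => n; first exact: pfn.
  by rewrite NegzE mulrNz -(pfn n.+1 i) scaleNr addrNK.
elim: s x => [|i s IHs] x; first by rewrite big_nil addr0.
by rewrite big_cons addrA IHs pfz.
Qed.

(** Subtracting from each coordinate its integer number of periods. *)
Lemma torus_periodic_cell f x : torus_periodic L f ->
  exists2 y : 'rV[R]_d, (forall i, 0 <= y ord0 i <= L) & f y = f x.
Proof.
move=> pf; pose z i := - Num.floor (x ord0 i / L).
exists (x + \sum_(i < d) (L *~ z i) *: delta_mx ord0 i); last first.
  by rewrite torus_periodic_int.
move=> i; rewrite mxE summxE (bigD1 i)//= big1 ?addr0; last first.
  by move=> j ji; rewrite !mxE eqxx/= eq_sym (negPf ji) mulr0.
rewrite !mxE !eqxx mulr1 /z mulrNz -mulrzr.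
apply/andP; split.
  by rewrite subr_ge0 mulrC -ler_pdivlMr// floor_le.
rewrite lerBlDr -{1}(mulr1 L) -mulrDr mulrC -ler_pdivrMr//.
by rewrite -(intrD _ 1) addrC ltW// floorD1_gt.
Qed.

Lemma compact_closed_cell :
  compact [set y : 'rV[R]_d | forall i, 0 <= y ord0 i <= L].
Proof.
have := @rV_compact R d (fun=> `[0, L]%classic) (fun=> @segment_compact _ _ _).
congr compact; apply/seteqP; split => y /= yL i; have := yL i; by rewrite in_itv.
Qed.

(** A periodic function takes all its values on the compact closed cell. *)
Lemma periodic_continuous_bounded f : torus_periodic L f -> continuous f ->
  exists2 M, 0 < M & forall x, `|f x| <= M.
Proof.
move=> pf cf.
have cell0 : [set y : 'rV[R]_d | forall i, 0 <= y ord0 i <= L] !=set0.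
  by exists 0 => i; rewrite mxE lexx ltW.
have cnf : continuous (fun x => `|f x|).
  by move=> x; apply: (@continuous_comp _ _ _ f); [exact: cf|exact: norm_continuous].
have [c _ cmax] := EVT_max_rV cell0 compact_closed_cell (continuous_subspaceT cnf).
exists (`|f c| + 1); first by rewrite ltr_wpDl.
move=> x; have [y yL fy] := torus_periodic_cell x pf.
by rewrite -fy (le_trans (cmax y _))// ?inE// lerDl.
Qed.

Lemma periodic_continuous_bounded_measurable f :
  torus_periodic L f -> continuous f -> bounded_measurable f.
Proof.
move=> pf cf; split; first exact: continuous_measurable_rV.
by have [M _ fM] := periodic_continuous_bounded pf cf; exists M.
Qed.

End torus_real.

(** * Derivatives along lines and smooth functions *)

Section directional.
Context {R : realType} {d : nat}.
Implicit Types (f g : 'rV[R]_d -> R) (x v : 'rV[R]_d).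

Lemma is_derive_line f x v (t : R) : derivable f (x + t *: v) v ->
  is_derive t 1 (fun s => f (x + s *: v)) ('D_v f (x + t *: v)).
Proof.
move=> df.
have E : (fun h : R => h^-1 *: (((fun s => f (x + s *: v)) \o shift t) (h *: (1 : R)) - f (x + t *: v))) =
         (fun h : R => h^-1 *: ((f \o shift (x + t *: v)) (h *: v) - f (x + t *: v))).
  apply/funext => h /=; congr (_ *: (f _ - _)).
  by rewrite [h *: 1]mulr1 scalerDl addrCA.
apply: DeriveDef; first by rewrite /derivable E.
by rewrite /derive E.
Qed.

(** The fundamental theorem of calculus along a coordinate segment; integrating
    over the circle of length h expresses it with a finite measure. *)
Lemma integral_partial_derive f (i : 'I_d) x (h : R) : 0 <= h ->
  (forall y, derivable f y (delta_mx ord0 i)) ->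
  continuous (partial_derive i f) ->
  \int[circle_measure h]_t partial_derive i f (x + t *: delta_mx ord0 i) =
  f (x + h *: delta_mx ord0 i) - f x.
Proof.
move=> h0 df cf; set e := delta_mx ord0 i.
pose g t := f (x + t *: e); pose g' t := partial_derive i f (x + t *: e).
have cg' : continuous g'.
  move=> t; apply: (@continuous_comp _ _ _ (fun t : R => x + t *: e)); last exact: cf.
  by apply: cvgD; [exact: cvg_cst|apply: cvgZr_tmp; exact: cvg_id].
have dg (t : R) : is_derive t 1 g (g' t) by exact: is_derive_line.
rewrite /Rintegral circle_integralE; last first.
  by apply/measurable_EFinP; exact: continuous_measurable_fun.
move: h0; rewrite le_eqVlt => /predU1P[<-|h0].
  by rewrite set_itv_ge ?bnd_simp ?integral_set0/= ?scale0r ?addr0 ?subrr.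
rewrite integral_itv_bndo_bndc; last first.
  apply/measurable_funTS/measurable_EFinP; exact: continuous_measurable_fun.
rewrite (@continuous_FTC2 _ g' g)//.
- by rewrite /= /g scale0r addr0.
- exact: continuous_subspaceT.
- have cg : continuous g.
    by move=> t; apply/differentiable_continuous/derivable1_diffP; have [] := dg t.
  split; first by move=> t _; have [] := dg t.
    by apply: cvg_at_right_filter; exact: cg.
  by apply: cvg_at_left_filter; exact: cg.
- by move=> t _; rewrite derive1E; have := dg t => ?; rewrite derive_val.
Qed.

End directional.

Section smooth.
Context {R : realType} {d : nat}.
Implicit Types (f g : 'rV[R]_d -> R) (x v : 'rV[R]_d).

Lemma is_derive_line0 f x v : derivable f x v ->
  is_derive (0 : R) 1 (fun s => f (x + s *: v)) ('D_v f x).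
Proof.
move=> df.
have E : (fun h : R => h^-1 *: (((fun s => f (x + s *: v)) \o shift 0) (h *: (1 : R)) - f (x + 0 *: v))) =
    (fun h : R => h^-1 *: ((f \o shift x) (h *: v) - f x)).
  apply/funext => h /=; rewrite [h *: 1]mulr1 addr0 scale0r addr0.
  by rewrite [h *: v + x]addrC.
by apply: DeriveDef; rewrite ?/derivable ?/derive E.
Qed.

(** Together with is_derive_line0: a directional derivative at a point is an
    ordinary derivative at 0, to which the one-variable calculus applies. *)
Lemma is_derive_of_line f x v (D : R) :
  is_derive (0 : R) 1 (fun s => f (x + s *: v)) D -> is_derive x v f D.
Proof.
case => d1 d2.
have E : (fun h : R => h^-1 *: ((f \o shift x) (h *: v) - f x)) =
    (fun h : R => h^-1 *: (((fun s => f (x + s *: v)) \o shift 0) (h *: (1 : R)) - f (x + 0 *: v))).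
  apply/funext => h /=; rewrite [h *: 1]mulr1 addr0 scale0r addr0.
  by rewrite [h *: v + x]addrC.
by apply: DeriveDef; rewrite ?/derivable ?/derive E.
Qed.

Lemma is_derive_chain (h : R -> R) f x v (D : R) :
  is_derive (f x) 1 h D -> derivable f x v ->
  is_derive x v (h \o f) (D * 'D_v f x).
Proof.
move=> dh df; apply: is_derive_of_line.
pose l := fun s => f (x + s *: v).
have dl : is_derive (0 : R) 1 l ('D_v f x) by exact: is_derive_line0.
have dl1 : derivable l (0 : R) 1 by case: dl.
have l0 : l 0 = f x by rewrite /l scale0r addr0.
have dh1 : derivable h (l 0) 1 by rewrite l0; case: dh.
have dhl : derivable (h \o l) (0 : R) 1.
  move/derivable1_diffP : (dl1) (dh1) => dfl /derivable1_diffP dfh.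
  exact/derivable1_diffP/(differentiable_comp dfl dfh).
apply: DeriveDef => //.
rewrite -derive1E; apply: etrans (derive1_comp dl1 dh1) _.
by rewrite !derive1E l0 !derive_val.
Qed.

Lemma Ck_continuous k f : Ck k f -> continuous f.
Proof. by case: k => [[]|k []]. Qed.

Lemma CkW k f : Ck k.+1 f -> Ck k f.
Proof.
elim: k f => [|k IHk] f [cf df]; first by split.
by split => // i; have [? ?] := df i; split => //; exact: IHk.
Qed.

(** Reduces the inductive step for each closure property below to computing one
    partial derivative and naming it. *)
Lemma Ck_ext k f (i : 'I_d) g :
  (forall x, is_derive x (delta_mx ord0 i) f (g x)) -> Ck k g ->
  (forall x, derivable f x (delta_mx ord0 i)) /\ Ck k (partial_derive i f).
Proof.
move=> fg kg; split; first by move=> x; have [] := fg x.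
suff -> : partial_derive i f = g by [].
by apply/funext => x; rewrite /partial_derive; have := fg x => ?; rewrite derive_val.
Qed.

Lemma Ck_cst k (c : R) : Ck k (fun _ : 'rV[R]_d => c).
Proof.
elim: k c => [|k IHk] c; split=> //; try exact: cst_continuous.
by move=> i; apply: (@Ck_ext k (fun=> c) i (fun=> 0)) => // x; exact: is_derive_cst.
Qed.

Lemma CkD k f g : Ck k f -> Ck k g -> Ck k (fun x => f x + g x).
Proof.
elim: k f g => [|k IHk] f g [cf df] [cg dg]; split=> //.
- by move=> x; apply: (@continuousD _ _ _ f g x); [exact: cf|exact: cg].
- by move=> x; apply: (@continuousD _ _ _ f g x); [exact: cf|exact: cg].
- move=> i; have [df1 df2] := df i; have [dg1 dg2] := dg i.
  apply: Ck_ext (IHk _ _ df2 dg2) => x.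
  by apply: is_deriveD; exact: derivableP.
Qed.

Lemma CkM k f g : Ck k f -> Ck k g -> Ck k (fun x => f x * g x).
Proof.
elim: k f g => [|k IHk] f g kf kg; split=> //.
- by move=> x; apply: (@continuousM _ _ f g x); [exact: (Ck_continuous kf)|exact: (Ck_continuous kg)].
- by move=> x; apply: (@continuousM _ _ f g x); [exact: (Ck_continuous kf)|exact: (Ck_continuous kg)].
- have [_ df] := kf; have [_ dg] := kg.
  move=> i; have [df1 df2] := df i; have [dg1 dg2] := dg i.
  apply: Ck_ext (CkD (IHk _ _ (CkW kf) dg2) (IHk _ _ (CkW kg) df2)) => x.
  by apply: is_deriveM; exact: derivableP.
Qed.

Lemma CkN k (f : 'rV[R]_d -> R) : Ck k f -> Ck k (fun x => - f x).
Proof.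
by move=> kf; under eq_fun do rewrite -mulN1r; apply: CkM => //; exact: Ck_cst.
Qed.

Lemma Ck_sum k n (F : 'I_n -> 'rV[R]_d -> R) : (forall j, Ck k (F j)) ->
  Ck k (fun x => \sum_(j < n) F j x).
Proof.
elim: n F => [|n IHn] F kF.
  by under eq_fun do rewrite big_ord0; exact: Ck_cst.
under eq_fun do rewrite big_ord_recl.
by apply: CkD => //; exact: (IHn (fun j => F (lift ord0 j))).
Qed.

(** The hypothesis on H says that H n.+1 is the derivative of H n; supplying the
    whole tower at once lets the induction on k go through without a notion of
    smoothness for functions of one variable. *)
Lemma Ck_comp (H : nat -> R -> R) k n f :
  (forall n (t : R), is_derive t 1 (H n) (H n.+1 t)) ->
  Ck k f -> Ck k (fun x => H n (f x)).
Proof.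
move=> dH; elim: k n f => [|k IHk] n f kf.
  all: split=> //; try (move=> x; apply: continuous_comp; first exact: (Ck_continuous kf);
    by apply/differentiable_continuous/derivable1_diffP; have [] := dH n (f x)).
have [_ df] := kf.
move=> i; have [df1 df2] := df i.
apply: Ck_ext (CkM (IHk n.+1 f (CkW kf)) df2) => x.
exact: is_derive_chain.
Qed.

Lemma Ck_expR k f : Ck k f -> Ck k (fun x => expR (f x)).
Proof. by apply: (@Ck_comp (fun=> expR) k 0%N) => n t; exact: is_derive_expR. Qed.

(** The tower of derivatives of sin is sin(t + n pi / 2), expanded by the
    addition formula. *)
Lemma Ck_sin k f : Ck k f -> Ck k (fun x => sin (f x)).
Proof.
pose c n : R := n%:R * (pi / 2).
pose H n (t : R) : R := sin t * cos (c n) + cos t * sin (c n).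
have H0 t : H 0%N t = sin t by rewrite /H /c mul0r cos0 sin0 mulr1 mulr0 addr0.
have := @Ck_comp H k 0%N f.
under eq_fun do rewrite H0; apply => n t.
have cS : c n.+1 = c n + pi / 2 by rewrite /c -natr1 mulrDl mul1r.
apply: is_derive_eq; rewrite /H cS cosDpihalf sinDpihalf.
rewrite !scaler0 !add0r -![_ *: _]/(_ * _); ring.
Qed.

Lemma Ck_coord k (i : 'I_d) : Ck k (fun x => x ord0 i).
Proof.
have cc : continuous (fun x : 'rV[R]_d => x ord0 i) by exact: coord_continuous.
case: k => [|k]; split => // j.
apply: (@Ck_ext k (fun x => x ord0 i) j (fun=> (i == j)%:R)); last exact: Ck_cst.
move=> x; apply: is_derive_of_line.
under eq_fun do rewrite !mxE eqxx/=.
apply: is_derive_eq.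
by rewrite add0r mul1r scaler0 add0r [_%:A]mulr1.
Qed.

Lemma Ck_shift k f v : Ck k f -> Ck k (fun x => f (x + v)).
Proof.
elim: k f => [|k IHk] f kf; split => //.
- move=> x; apply: (@continuous_comp _ _ _ (fun x => x + v)); last exact: (Ck_continuous kf).
  by apply: (@continuousD _ _ _ id (cst v) x); [exact: cvg_id|exact: cst_continuous].
- move=> x; apply: (@continuous_comp _ _ _ (fun x => x + v)); last exact: (Ck_continuous kf).
  by apply: (@continuousD _ _ _ id (cst v) x); [exact: cvg_id|exact: cst_continuous].
- move=> i; have [_ /(_ i)[df1 df2]] := kf.
  apply: Ck_ext (IHk _ df2) => x.
  apply: is_derive_of_line.
  have := @is_derive_line _ _ f (x + v) (delta_mx ord0 i) 0 (df1 _).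
  rewrite scale0r addr0.
  by under eq_fun do rewrite addrAC.
Qed.
End smooth.

(** * The fundamental lemma of the calculus of variations *)

Section cutoff.
Context {R : realType} {d : nat}.
Variable L : R.
Hypothesis L0 : 0 < L.
Implicit Types (x s : 'rV[R]_d).

Local Notation vol := (torus_measure L d).

(** For 0 <= a <= L this function of t is L-periodic, since both sines change sign
    over a period, it is positive on ]0, a[ and nonpositive on [a, L[. *)
Definition gate (a t : R) := sin (pi * (t / L)) * sin (pi * ((a - t) / L)).

(** An expression that is smooth and periodic in x, and whose limit in n is the
    indicator of an orthant: n exp(- n g) tends to 0 for g > 0 and is at least n
    for g <= 0, so the outer exponential tends to 1 where all gates are positive
    and to 0 where some gate is not. *)
Definition cutoff s (n : nat) x : R :=
  expR (- \sum_(i < d) n%:R * expR (- (n%:R * gate (s ord0 i) (x ord0 i)))).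

Lemma gate_periodic a t : gate a (t + L) = gate a t.
Proof.
rewrite /gate.
have Ln0 : L != 0 by rewrite gt_eqF.
have -> : (t + L) / L = t / L + 1 by field.
have -> : (a - (t + L)) / L = (a - t) / L - 1 by field.
rewrite mulrDr mulr1 sinDpi mulrBr mulr1.
have := sinDpi (pi * ((a - t) / L) - pi); rewrite subrK => ->.
by rewrite mulNr mulrN.
Qed.

Lemma gate_gt0 a t : 0 < t < L -> a <= L -> t < a -> 0 < gate a t.
Proof.
move=> /andP[t0 tL] aL ta; have H r : 0 < r < L -> 0 < sin (pi * (r / L)).
  move=> /andP[r0 rL]; apply: sin_gt0_pi; apply/andP; split.
    by apply: mulr_gt0; [exact: pi_gt0|exact: divr_gt0].
  by rewrite gtr_pMr ?pi_gt0// ltr_pdivrMr// mul1r.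
by apply: mulr_gt0; apply: H; lra.
Qed.

Lemma gate_le0 a t : 0 < t < L -> 0 <= a -> a <= t -> gate a t <= 0.
Proof.
move=> /andP[t0 tL] a0 at_.
rewrite /gate -(opprB t a) mulNr mulrN sinN mulrN oppr_le0.
have H r : 0 <= r <= L -> 0 <= sin (pi * (r / L)).
  move=> /andP[r0 rL]; apply: sin_ge0_pi; apply/andP; split.
    by apply: mulr_ge0; [exact: pi_ge0|apply: divr_ge0; lra].
  by rewrite ger_pMr ?pi_gt0// ler_pdivrMr// mul1r.
by apply: mulr_ge0; apply: H; lra.
Qed.

Lemma cutoff_test s n : test_function L (cutoff s n).
Proof.
split.
  move=> i x; congr (expR (- _)); apply: eq_bigr => j _.
  congr (_ * expR (- (_ * _))); rewrite !mxE eqxx/=.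
  have [->|_] := eqVneq j i; first by rewrite mulr1 gate_periodic.
  by rewrite mulr0 addr0.
move=> k; apply: Ck_expR; apply: CkN; apply: Ck_sum => i.
apply: CkM; first exact: Ck_cst.
apply: Ck_expR; apply: CkN; apply: CkM; first exact: Ck_cst.
apply: CkM; apply: Ck_sin.
  apply: CkM; first exact: Ck_cst.
  by apply: CkM; [exact: Ck_coord|exact: Ck_cst].
apply: CkM; first exact: Ck_cst.
apply: CkM; last exact: Ck_cst.
by apply: CkD; [exact: Ck_cst|apply: CkN; exact: Ck_coord].
Qed.

Lemma cutoff_le1 s n x : 0 <= cutoff s n x <= 1.
Proof.
rewrite expR_ge0/= -expR0 ler_expR oppr_le0.
by apply: sumr_ge0 => i _; rewrite mulr_ge0// expR_ge0.
Qed.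

(** From exp y >= y^2 / 2. *)
Lemma cvg_gate (g : R) : 0 < g ->
  n.+1%:R * expR (- (n.+1%:R * g)) @[n --> \oo] --> (0 : R).
Proof.
move=> g0.
have h0 : (2 / g ^+ 2) * harmonic n @[n --> \oo] --> (0 : R).
  rewrite -[X in _ --> X](mulr0 (2 / g ^+ 2)); apply: cvgM; first exact: cvg_cst.
  exact: cvg_harmonic.
apply: (squeeze_cvgr _ (cvg_cst 0) h0); apply: nearW => n /=.
rewrite mulr_ge0 ?expR_ge0//= expRN.
have ng0 : 0 < n.+1%:R * g by rewrite mulr_gt0.
have := expR_ge1Dxn 1 (ltW ng0).
set e := expR _ => ege.
have e0 : 0 < e by exact: expR_gt0.
rewrite ler_pdivrMr// /harmonic/=.
have {}ege : (n.+1%:R * g) ^+ 2 / 2 <= e by move: ege; rewrite !factS fact0; lra.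
rewrite [leLHS](_ : _ = 2 / g ^+ 2 * n.+1%:R^-1 * ((n.+1%:R * g) ^+ 2 / 2)); last first.
  by field; rewrite !gt_eqF.
by apply: ler_wpM2l => //; rewrite mulr_ge0 ?invr_ge0// divr_ge0// sqr_ge0.
Qed.

Lemma cvg_sum0 k (F : 'I_k -> nat -> R) :
  (forall i, F i n @[n --> \oo] --> (0 : R)) ->
  \sum_(i < k) F i n @[n --> \oo] --> (0 : R).
Proof.
elim: k F => [|k IHk] F F0.
  by under eq_cvg do rewrite big_ord0; exact: cvg_cst.
rewrite (_ : (fun n => _) =
    (fun n => F ord0 n + \sum_(i < k) F (lift ord0 i) n)); last first.
  by apply/funext => n; rewrite big_ord_recl.
have := cvgD (F0 ord0) (IHk (fun i => F (lift ord0 i)) (fun i => F0 _)).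
by rewrite addr0 => H; exact: H.
Qed.

Lemma cvg_cutoff s x : (forall i, 0 < x ord0 i < L) ->
  (forall i, 0 <= s ord0 i <= L) ->
  cutoff s n.+1 x @[n --> \oo] -->
    (\1_[set y : 'rV[R]_d | forall i, y ord0 i < s ord0 i] x : R).
Proof.
move=> xL sL; rewrite indicE.
have [xs|] := boolP (x \in _).
  rewrite [X in _ --> X](_ : _ = expR (- (\sum_(i < d) (0 : R)))); last first.
    by rewrite big1// oppr0 expR0.
  apply: continuous_cvg; first exact: continuous_expR.
  apply: cvgN.
  rewrite big1//; apply: (@cvg_sum0 d (fun i n => n.+1%:R * expR (- (n.+1%:R * gate (s ord0 i) (x ord0 i))))) => i.
  by apply/cvg_gate/gate_gt0 => //; have /andP[_] := sL i; have := set_mem xs.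
move=> /negP; rewrite inE/= => /existsNP[i /negP]; rewrite -leNgt => si.
have le n : cutoff s n.+1 x <= expR (- n.+1%:R).
  rewrite ler_expR lerN2 (bigD1 i)//=.
  rewrite ler_wpDr//; first by apply: sumr_ge0 => j _; rewrite mulr_ge0// expR_ge0.
  rewrite ler_peMr// -expR0 ler_expR oppr_ge0 pmulr_rle0//.
  by apply: gate_le0 => //; have /andP[] := sL i.
have h0 : expR (- n.+1%:R) @[n --> \oo] --> (0 : R).
  by have := @cvgn_expR R; rewrite -(cvg_shiftS (fun n => expR (- n%:R))).
apply: (squeeze_cvgr _ (cvg_cst 0) h0).
by apply: nearW => n; have /andP[-> _] := cutoff_le1 s n.+1 x; rewrite le.
Qed.

End cutoff.

Section fundamental.
Context {R : realType} {d : nat}.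
Variable L : R.
Hypothesis L0 : 0 < L.
Implicit Types (x s : 'rV[R]_d).

Local Notation vol := (torus_measure L d).

Definition orthant s : set 'rV[R]_d := [set x | forall i, x ord0 i < s ord0 i].

Lemma measurable_orthant s : measurable (orthant s).
Proof.
rewrite (_ : orthant s = \bigcap_(i in [set: 'I_d])
    ((fun x => x ord0 i) @^-1` `]-oo, s ord0 i[%classic)).
  apply: fin_bigcap_measurable => // i _.
  by rewrite -[X in measurable X]setTI; apply: measurable_coord.
by apply/seteqP; split => [x xs i _|x xs i]; [|have := xs i I]; rewrite /= in_itv/=.
Qed.

(** Each half-space x_i < a is the increasing union of the orthants whose other
    bounds are k, and the half-spaces generate the Borel sets. *)
Lemma orthants_generate : @measurable _ 'rV[R]_d = <<s range orthant >>.
Proof.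
apply/seteqP; split; last first.
  apply: smallest_sub; first exact: sigma_algebra_measurable.
  by move=> _ [s _ <-]; exact: measurable_orthant.
pose T := g_sigma_algebraType (range orthant).
have mi : measurable_fun [set: T] (fun x : T => x : 'rV[R]_d).
  apply: measurable_fun_rV => i.
  apply: (measurability _ (measurable_realfun.RGenInftyO.measurableE R)).
  move=> _ [_ [a ->] <-]; rewrite setTI.
  rewrite (_ : _ @^-1` _ = \bigcup_k orthant (\row_j (if j == i then a else k%:R))).
    by apply: bigcupT_measurable => k; apply: sub_sigma_algebra; eexists.
  apply/seteqP; split => [x /=|x [k _] /(_ i)]; last by rewrite !mxE eqxx /= in_itv.
  rewrite in_itv/= => xa; exists (Num.bound (\sum_j `|x ord0 j|)) => // j.
  rewrite mxE; case: eqP => [->//|_].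
  apply: le_lt_trans (archi_boundP _); last exact: sumr_ge0.
  by rewrite (bigD1 j)//= (le_trans (ler_norm _))// lerDl sumr_ge0.
move=> A mA; have := mi measurableT A mA; rewrite setTI; exact.
Qed.

(** On the open cell the orthant may be replaced by the one with vertex clamped
    to the closed cell, where the cutoffs converge; they are bounded by 1, so
    dominated convergence applies. *)
Lemma orthant_integral (v : 'rV[R]_d -> R) s : intg vol v ->
  (forall phi, test_function L phi -> \int[vol]_x (v x * phi x) = 0) ->
  (\int[vol]_(x in orthant s) (v x)%:E = 0)%E.
Proof.
move=> vi v0.
pose s' : 'rV[R]_d := \row_i Num.min (Num.max (s ord0 i) 0) L.
have s'L i : 0 <= s' ord0 i <= L.
  by rewrite mxE le_min le_max lexx orbT ge_min lexx orbT ltW.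
have ss' x : (forall i, 0 < x ord0 i < L) -> orthant s x <-> orthant s' x.
  move=> xL; split => xs i; have := xs i; have /andP[x0 xL'] := xL i; rewrite mxE.
    by rewrite lt_min lt_max xL' andbT => ->.
  by rewrite lt_min lt_max xL' andbT => /orP[//|]; rewrite ltNge (ltW x0).
have mv := intg_measurable vi.
pose f x := (v x * \1_(orthant s') x)%:E.
have mf : measurable_fun setT f.
  apply/measurable_EFinP/measurable_funM => //.
  by apply: measurable_indic; exact: measurable_orthant.
pose f_ n x := (v x * cutoff L s' n.+1 x)%:E.
have cb n : bounded_measurable (cutoff L s' n).
  split.
    apply: continuous_measurable_rV.
    by have [_ /(_ 0%N)[]] := cutoff_test L0 s' n.
  by exists 1 => x; have /andP[c0 c1] := cutoff_le1 L s' n x; rewrite ger0_norm.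
have fi n : intg vol (fun x => v x * cutoff L s' n x) by exact: intg_mul.
have f0 n : (\int[vol]_x f_ n x = 0)%E.
  have := v0 _ (cutoff_test L0 s' n.+1); rewrite /Rintegral => H.
  by rewrite /f_ -[LHS]fineK ?H//; exact: integrable_fin_num (fi _).
have cf : {ae vol, forall x, setT x -> f_ ^~ x @ \oo --> f x}.
  apply: filterS (ae_open_cell d L0) => x xL _.
  apply/fine_cvgP; split; first exact: nearW.
  apply: cvgM; first exact: cvg_cst.
  exact: cvg_cutoff.
have dom : {ae vol, forall x n, setT x -> (`|f_ n x| <= `|v x|%:E)%E}.
  apply: aeW => x n _ /=; rewrite lee_fin normrM.
  have /andP[c0 c1] := cutoff_le1 L s' n.+1 x.
  by rewrite (ger0_norm c0) ler_piMr.
have mf_ n : measurable_fun setT (f_ n) by exact: measurable_int (fi n.+1).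
have [_ _ cvgI] := dominated_convergence measurableT mf_ mf cf (intg_norm vi) dom.
have If : (\int[vol]_x f x = 0)%E.
  move: cvgI; rewrite (_ : (fun n => _) = cst 0%E); last first.
    by apply/funext => n; exact: f0.
  by move=> cvg0; apply: cvg_unique cvg0 (cvg_cst _).
rewrite -If integral_mkcond; apply: ae_eq_integral => //.
  apply/(measurable_restrictT _ _).1; first exact: measurable_orthant.
  exact/measurable_funTS/measurable_EFinP.
apply: filterS (ae_open_cell d L0) => x xL _.
rewrite patchE /f indicE; case: ifPn => xs.
  by rewrite mem_set ?mulr1//; apply/ss' => //; exact: set_mem xs.
rewrite memNset ?mulr0// => xs'; move/negP : xs; apply.
by apply/mem_set/ss'.
Qed.

(** Orthants are stable under intersection and generate the Borel sets, so the
    integral of v over every Borel set vanishes. *)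
Lemma fundamental_lemma (v : 'rV[R]_d -> R) : intg vol v ->
  (forall phi, test_function L phi -> \int[vol]_x (v x * phi x) = 0) ->
  ae_eq vol setT v (cst 0).
Proof.
move=> vi v0.
have vT : (\int[vol]_x (v x)%:E = 0)%E.
  have := v0 (fun=> 1) (conj (fun _ _ => erefl) (fun k => Ck_cst k 1)).
  under eq_Rintegral do rewrite mulr1.
  by rewrite /Rintegral => H; rewrite -[LHS]fineK ?H//; exact: integrable_fin_num vi.
have vA A : measurable A -> (\int[vol]_(x in A) (v x)%:E = 0)%E.
  rewrite orthants_generate.
  apply: (@dynkin_induction _ 'rV[R]_d (range orthant)
    (fun A => (\int[vol]_(x in A) (v x)%:E = 0)%E) orthants_generate).
  - move=> _ _ [s _ <-] [t _ <-]; exists (\row_i Num.min (s ord0 i) (t ord0 i)) => //.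
    apply/seteqP; split => x /=.
      by move=> H; split => i; have := H i; rewrite mxE lt_min => /andP[].
    by move=> [H1 H2] i; rewrite mxE lt_min; apply/andP; split; [exact: H1|exact: H2].
  - exact: vT.
  - by move=> _ [s _ <-]; exact: orthant_integral.
  - move=> S mS S0.
    have := vT; rewrite -(setUv S) integral_setU//.
    + by rewrite S0 add0e.
    + exact: measurableC.
    + apply/measurable_funTS/measurable_EFinP; exact: (intg_measurable vi).
    + by apply/disj_setPS; rewrite setICr.
  - move=> F mF tF F0; rewrite integral_bigcup//; first exact: eseries0.
    by apply: integrableS vi => //; exact: bigcupT_measurable.
have := @integral_ae_eq _ _ _ vol setT measurableT (cst 0) (EFin \o v) vi.
move=> H; have {}H : ae_eq vol setT (EFin \o v) (cst 0%E).
  apply: H => // E _ mE; rewrite vA// integral_cst ?mul0e//.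
by apply: filterS H => x H Dx; have [] := H Dx.
Qed.
End fundamental.

(** * A Poincare inequality in weak form *)

Section increments.
Context {R : realType} {d : nat}.
Variable L : R.
Hypothesis L0 : 0 < L.
Implicit Types (x h : 'rV[R]_d) (zeta : 'rV[R]_d -> R).

Local Notation vol := (torus_measure L d).
Local Notation e_ i := (delta_mx ord0 i : 'rV[R]_d).

Lemma test_function_shift (phi : 'rV[R]_d -> R) (h : 'rV[R]_d) :
  test_function L phi -> test_function L (fun x => phi (x + h)).
Proof.
move=> [pp kp]; split; first exact: torus_periodic_shift.
by move=> k; exact: Ck_shift.
Qed.

Lemma partial_derive_shift i (phi : 'rV[R]_d -> R) h :
  (forall y, derivable phi y (e_ i)) ->
  partial_derive i (fun x => phi (x + h)) = (fun x => partial_derive i phi (x + h)).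
Proof.
move=> dphi; apply/funext => x; rewrite /partial_derive.
suff H : is_derive x (e_ i) (fun x : 'rV[R]_d => phi (x + h)) ('D_(e_ i) phi (x + h)).
  by rewrite derive_val.
apply: is_derive_of_line.
have := is_derive_line0 (dphi (x + h)).
by under eq_fun do rewrite addrAC.
Qed.

Lemma test_bounded_measurable (phi : 'rV[R]_d -> R) :
  test_function L phi -> bounded_measurable phi.
Proof.
move=> [pp kp]; apply: (periodic_continuous_bounded_measurable L0) => //.
exact: (Ck_continuous (kp 0%N)).
Qed.

Lemma partial_derive_periodic i (phi : 'rV[R]_d -> R) :
  torus_periodic L phi -> torus_periodic L (partial_derive i phi).
Proof.
move=> pp j x; rewrite /partial_derive /derive.
suff -> : (fun t : R => t^-1 *: ((phi \o shift (x + L *: delta_mx ord0 j)) (t *: e_ i)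
    - phi (x + L *: delta_mx ord0 j))) =
    (fun t : R => t^-1 *: ((phi \o shift x) (t *: e_ i) - phi x)) by [].
by apply/funext => t /=; rewrite addrA !pp.
Qed.

Lemma measurable_ray i (s : R) :
  measurable_fun setT (fun z : measurableTypeR R * 'rV[R]_d => z.2 + (s * z.1) *: e_ i).
Proof.
apply: measurable_fun_rV => j.
have m1 : measurable_fun setT (fun z : measurableTypeR R * 'rV[R]_d => z.2 ord0 j).
  exact: (measurableT_comp (@measurable_coord R d j) measurable_snd).
have m2 : measurable_fun setT (fun z : measurableTypeR R * 'rV[R]_d => (s * z.1) * e_ i ord0 j).
  apply: measurable_funM => //; apply: measurable_funM => //; exact: measurable_fst.
by apply: eq_measurable_fun (measurable_funD m1 m2) => z _; rewrite /= !mxE.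
Qed.

Lemma measurable_sum : measurable_fun setT (fun z : 'rV[R]_d * 'rV[R]_d => z.1 + z.2).
Proof.
apply: measurable_fun_rV => j.
have m1 := measurableT_comp (@measurable_coord R d j) (@measurable_fst _ _ 'rV[R]_d 'rV[R]_d).
have m2 := measurableT_comp (@measurable_coord R d j) (@measurable_snd _ _ 'rV[R]_d 'rV[R]_d).
by apply: eq_measurable_fun (measurable_funD m1 m2) => z _; rewrite /= mxE.
Qed.

Variables (u : 'rV[R]_d -> R) (G : 'I_d -> 'rV[R]_d -> R).
Hypothesis bu : bounded_measurable u.
Hypothesis pu : torus_periodic L u.
Hypothesis pG : forall i, torus_periodic L (G i).
Hypothesis Gi : forall i, intg vol (G i).
Hypothesis G2 : forall i, intg vol (fun x => G i x ^+ 2).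
Hypothesis uG : weak_gradient L u G.

(** G i is only integrable, not bounded: its integral over the torus is the same
    for all translates, which dominates the iterated integral. *)
Lemma intg2_ray (i : 'I_d) (h : R) zeta : bounded_measurable zeta ->
  intg2 (circle_measure h) vol
    (fun z : measurableTypeR R * 'rV[R]_d => G i (z.2 + (- 1 * z.1) *: e_ i) * zeta z.2).
Proof.
move=> [mz [M zM]].
have mG := intg_measurable (Gi i).
have mF : measurable_fun setT
    (fun z : measurableTypeR R * 'rV[R]_d => G i (z.2 + (- 1 * z.1) *: e_ i) * zeta z.2).
  apply: measurable_funM; first exact: (measurableT_comp mG (measurable_ray _ _)).
  exact: (measurableT_comp mz measurable_snd).
apply: (@intg2_iterated _ _ _ _ _ _ _ _ (fun=> M * \int[vol]_x `|G i x|)) => //.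
  exact: intg_cst.
move=> t /=.
pose k := (- 1 * t) *: e_ i.
have GK : intg vol (fun x => G i (x + k)) by exact: intg_torus_shift.
have -> : (M * \int[vol]_x `|G i x|)%:E = (\int[vol]_x (M * `|G i (x + k)|)%:E)%E.
  rewrite -[RHS]fineK; last exact: integrable_fin_num (intgZ M (intg_norm GK)).
  congr (_%:E); rewrite -[RHS]/(\int[vol]_x (M * `|G i (x + k)|)).
  rewrite RintegralZl//; last exact: intg_norm GK.
  congr (_ * _); apply/esym.
  apply: (@Rtorus_shift _ _ _ L0 (fun x => `|G i x|)) => //; first exact: measurableT_comp.
  by move=> j x; rewrite pG.
apply: ge0_le_integral => //.
- apply/measurable_EFinP/measurableT_comp => //; apply: measurable_funM => //.
  exact: intg_measurable GK.
- apply/measurable_EFinP/measurable_funM => //; apply: measurableT_comp => //.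
  exact: intg_measurable GK.
- by move=> x _; rewrite lee_fin normrM mulrC ler_wpM2r.
Qed.

(** Move the increment onto phi by translation invariance, write the increment of
    phi as the integral of its partial derivative, and use the definition of the
    weak gradient on each translate of phi. *)
Lemma weak_increment_test (i : 'I_d) (h : R) phi : 0 <= h -> test_function L phi ->
  \int[vol]_x ((u (x + (- h) *: e_ i) - u x) * phi x) =
  - \int[circle_measure h]_t \int[vol]_x (G i (x + (- 1 * t) *: e_ i) * phi x).
Proof.
move=> h0 tphi.
have bphi := test_bounded_measurable tphi.
have [pphi kphi] := tphi.
have [cphi /(_ i)[dphi [cdphi _]]] := kphi 1%N.
have bdphi : bounded_measurable (partial_derive i phi).
  apply: (periodic_continuous_bounded_measurable L0) => //.
  exact: partial_derive_periodic.
have bush k := bounded_measurable_shift k bu.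
have bphish k := bounded_measurable_shift k bphi.
transitivity (\int[vol]_x (u x * (phi (x + h *: e_ i) - phi x))).
  under eq_Rintegral do rewrite mulrBl.
  under [RHS]eq_Rintegral do rewrite mulrBr.
  rewrite !RintegralB//; try exact/bounded_measurable_intg/bounded_measurableM.
  congr (_ - _).
  rewrite -(Rtorus_shift L0 (h *: e_ i)); last 2 first.
  - by apply: measurable_funM; [exact: (bush _).1|exact: bphi.1].
  - by move=> j x; rewrite addrAC pu pphi.
  by apply: eq_Rintegral => x _; rewrite scaleNr addrK.
transitivity (\int[vol]_x (\int[circle_measure h]_t
    (u x * partial_derive i phi (x + (1 * t) *: e_ i)))).
  apply: eq_Rintegral => x _; rewrite -integral_partial_derive//.
  under [RHS]eq_Rintegral do rewrite mul1r.
  rewrite RintegralZl//; apply: bounded_measurable_intg.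
  split; last by have [_ [M HM]] := bdphi; exists M.
  have := measurable_ray i 1 => mr.
  have := measurableT_comp bdphi.1 (measurableT_comp mr (pair2_measurable x)).
  by under eq_fun do rewrite /= mul1r.
have i2 : intg2 (circle_measure h) vol (fun z : measurableTypeR R * 'rV[R]_d =>
    u z.2 * partial_derive i phi (z.2 + (1 * z.1) *: e_ i)).
  apply: intg2_bounded.
    apply: measurable_funM; first exact: (measurableT_comp bu.1 measurable_snd).
    exact: (measurableT_comp bdphi.1 (measurable_ray _ _)).
  have [_ [M HM]] := bdphi; have [_ [N HN]] := bu.
  by exists (N * M) => z; rewrite normrM ler_pM.
have [_ _ _ <-] := Rfubini i2.
transitivity (\int[circle_measure h]_t
    (- \int[vol]_x (G i (x + (- 1 * t) *: e_ i) * phi x))).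
  apply: eq_Rintegral => t _; under eq_Rintegral do rewrite /= mul1r.
  have tphit := test_function_shift (t *: e_ i) tphi.
  have := uG i tphit; rewrite partial_derive_shift// => ->; congr (- _).
  rewrite -[RHS](Rtorus_shift L0 (t *: e_ i)); last 2 first.
  - apply: measurable_funM; last exact: bphi.1.
    exact: intg_measurable (intg_torus_shift L0 _ (Gi i) (pG i)).
  - by move=> j x; rewrite addrAC pG pphi.
  by apply: eq_Rintegral => x _; rewrite mulN1r scaleNr addrK.
rewrite RintegralN//.
by have [] := Rfubini (@intg2_ray i h phi bphi).
Qed.

(** The increment of u and the integral of G i along the segment have the same
    pairing with every test function, hence agree almost everywhere. *)
Lemma weak_increment (i : 'I_d) (h : R) zeta : 0 <= h -> bounded_measurable zeta ->
  \int[vol]_x ((u (x + (- h) *: e_ i) - u x) * zeta x) =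
  - \int[circle_measure h]_t \int[vol]_x (G i (x + (- 1 * t) *: e_ i) * zeta x).
Proof.
move=> h0 bz.
pose F z x := \int[circle_measure h]_t (G i (x + (- 1 * t) *: e_ i) * z x).
have Fi z : bounded_measurable z -> intg vol (F z) /\
    \int[circle_measure h]_t \int[vol]_x (G i (x + (- 1 * t) *: e_ i) * z x) =
    \int[vol]_x F z x.
  by move=> bz'; have [_ ? _ ->] := Rfubini (@intg2_ray i h z bz').
have [I1 _] := Fi _ (bounded_measurable_cst 1).
(* The integral of G i along the segment issued from x, which converges for almost
   every x. *)
pose I x := F (fun=> 1) x.
have Iz z : bounded_measurable z -> intg vol (fun x => I x * z x).
  exact: intg_mul.
have FE z : bounded_measurable z -> \int[vol]_x F z x = \int[vol]_x (I x * z x).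
  move=> bz'; apply: ae_eq_Rintegral; first by have [] := Fi _ bz'.
    exact: intg_measurable (Iz _ bz').
  have := ae_integrable2 (@intg2_ray i h _ (bounded_measurable_cst 1)).
  apply: filterS => x ix _; rewrite /F /I /F.
  under [in RHS]eq_Rintegral do rewrite mulr1.
  rewrite RintegralZr//; move: ix; apply: eq_integrable => // t _.
  by rewrite /= mulr1.
pose w x := u (x + (- h) *: e_ i) - u x.
have bw : bounded_measurable w.
  by apply: bounded_measurableB => //; exact: (bounded_measurable_shift _ bu).
pose v x := w x + I x.
have vi : intg vol v by apply: intgD => //; exact: bounded_measurable_intg.
have vE z : bounded_measurable z ->
    \int[vol]_x (v x * z x) = \int[vol]_x (w x * z x) + \int[vol]_x F z x.
  move=> bz'; rewrite FE//; under eq_Rintegral do rewrite mulrDl.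
  by rewrite RintegralD//; [exact/bounded_measurable_intg/bounded_measurableM|exact: Iz].
have v0 : ae_eq vol setT v (cst 0).
  apply: (fundamental_lemma L0 vi) => phi tphi.
  have bphi := test_bounded_measurable tphi.
  rewrite vE// weak_increment_test// (Fi _ bphi).2 addNr//.
have : \int[vol]_x (v x * zeta x) = 0.
  rewrite (@ae_eq_Rintegral _ _ _ vol _ (fun=> 0)) ?Rintegral_cst ?mul0r//.
    exact: intg_mul.
  by apply: filterS v0 => x vx _; rewrite vx// mul0r.
by rewrite vE// (Fi _ bz).2 => /eqP; rewrite addr_eq0 => /eqP.
Qed.

(** Young's inequality on each slice of the segment; translations do not change
    the two integrals of squares. *)
Lemma increment_bound (l : R) (i : 'I_d) (h : R) zeta : 0 < l -> 0 <= h ->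
  bounded_measurable zeta -> torus_periodic L zeta ->
  `|\int[vol]_x ((u (x + h *: e_ i) - u x) * zeta x)| <=
  h * (l / 2 * \int[vol]_x (G i x ^+ 2) + (\int[vol]_x (zeta x ^+ 2)) / (2 * l)).
Proof.
move=> l0 h0 bz pz.
set C := (X in h * X).
pose z' x := zeta (x + (- h) *: e_ i).
have bz' : bounded_measurable z' by exact: bounded_measurable_shift.
have sqr (f : 'rV[R]_d -> R) : bounded_measurable f -> intg vol (fun x => f x ^+ 2).
  by move=> bf; apply: bounded_measurable_intg; exact: bounded_measurableM.
have -> : \int[vol]_x ((u (x + h *: e_ i) - u x) * zeta x) =
    - \int[vol]_x ((u (x + (- h) *: e_ i) - u x) * z' x).
  rewrite -RintegralN//; last first.
    apply/bounded_measurable_intg/bounded_measurableM => //.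
    by apply: bounded_measurableB => //; exact: (bounded_measurable_shift _ bu).
  rewrite -[RHS](Rtorus_shift L0 (h *: e_ i)).
  - apply: eq_Rintegral => x _; rewrite /z' -!addrA !scaleNr subrr addr0.
    by rewrite -mulNr opprB.
  - apply: measurableT_comp => //; apply: measurable_funM; last exact: bz'.1.
    by apply: measurable_funB; [exact: (bounded_measurable_shift _ bu).1|exact: bu.1].
  - move=> j x; rewrite /z' pu (torus_periodic_shift _ pu j x).
    by rewrite (torus_periodic_shift _ pz j x).
rewrite weak_increment// opprK.
have i2 := @intg2_ray i h z' bz'.
have [I1 _ _ _] := Rfubini i2.
rewrite (le_trans (le_normr_Rintegral measurableT I1))//.
have -> : h * C = \int[circle_measure h]_t C by rewrite Rintegral_cst// circle_measureT// mulrC.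
apply: le_Rintegral => //; [exact: intg_norm|exact: intg_cst|].
move=> t _ /=.
have mG := intg_measurable (intg_torus_shift L0 ((- 1 * t) *: e_ i) (Gi i) (pG i)).
rewrite (le_trans (Rintegral_young l0 mG bz'.1 _ (sqr _ bz')))//.
  apply: (intg_torus_shift (f := fun x => G i x ^+ 2) L0 _ (G2 i)).
  by move=> j x; rewrite pG.
rewrite /C lerD//.
  rewrite ler_wpM2l ?divr_ge0 ?(ltW l0)// (@Rtorus_shift _ _ _ L0 (fun x => G i x ^+ 2))//.
    exact: intg_measurable (G2 i).
  by move=> j x; rewrite pG.
rewrite ler_wpM2r ?invr_ge0 ?mulr_ge0 ?(ltW l0)// (@Rtorus_shift _ _ _ L0 (fun x => zeta x ^+ 2))//.
  exact: intg_measurable (sqr _ bz).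
by move=> j x; rewrite pz.
Qed.

(** A general translation is done one coordinate at a time, so that each step is
    an increment of u paired with a translate of zeta. *)
Lemma translation_bound (l : R) (s : seq 'I_d) h zeta : 0 < l ->
  (forall i, 0 <= h ord0 i <= L) ->
  bounded_measurable zeta -> torus_periodic L zeta ->
  `|\int[vol]_x ((u (x + \sum_(i <- s) h ord0 i *: e_ i) - u x) * zeta x)| <=
  \sum_(i <- s) L *
    (l / 2 * \int[vol]_x (G i x ^+ 2) + (\int[vol]_x (zeta x ^+ 2)) / (2 * l)).
Proof.
move=> l0 hL bz pz; elim: s => [|i s IHs].
  rewrite !big_nil; under eq_Rintegral do rewrite addr0 subrr mul0r.
  by rewrite Rintegral_cst// mul0r normr0.
rewrite big_cons; set S := \sum_(j <- s) _ in IHs *; rewrite [leRHS]big_cons.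
have bush k := bounded_measurable_shift k bu.
pose z' x := zeta (x + - S).
have bz' : bounded_measurable z' by exact: bounded_measurable_shift.
have pz' : torus_periodic L z' by exact: torus_periodic_shift.
have -> : \int[vol]_x ((u (x + (h ord0 i *: e_ i + S)) - u x) * zeta x) =
    \int[vol]_x ((u (x + h ord0 i *: e_ i) - u x) * z' x) +
    \int[vol]_x ((u (x + S) - u x) * zeta x).
  rewrite -(Rtorus_shift L0 S (f := fun x => (u (x + h ord0 i *: e_ i) - u x) * z' x)).
  - rewrite -RintegralD//.
    + apply: eq_Rintegral => x _; rewrite /z' addrK -mulrDl.
      by rewrite (addrC _ S) addrA addrA subrK.
    + apply: (intg_torus_shift L0 (f := fun x => (u (x + h ord0 i *: e_ i) - u x) * z' x)).
        by apply/bounded_measurable_intg/bounded_measurableM => //; exact: bounded_measurableB.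
      by move=> j x; rewrite pu pz' (torus_periodic_shift _ pu j x).
    + by apply/bounded_measurable_intg/bounded_measurableM => //; exact: bounded_measurableB.
  - by apply: (bounded_measurableM _ bz').1; exact: bounded_measurableB.
  - by move=> j x; rewrite pu pz' (torus_periodic_shift _ pu j x).
rewrite (le_trans (ler_normD _ _))// lerD//.
have /andP[h0 hiL] := hL i.
rewrite (le_trans (increment_bound i l0 h0 bz' pz'))//.
rewrite (@Rtorus_shift _ _ _ L0 (fun x => zeta x ^+ 2)); last 2 first.
- by apply: (bounded_measurableM bz bz).1.
- by move=> j x; rewrite pz.
rewrite ler_wpM2r// addr_ge0//.
  by rewrite mulr_ge0 ?divr_ge0 ?(ltW l0)// Rintegral_ge0// => x _; exact: sqr_ge0.
rewrite divr_ge0//; last by rewrite mulr_ge0// ltW.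
by rewrite Rintegral_ge0// => x _; exact: sqr_ge0.
Qed.

(** As zeta has mean zero, L^d int u zeta = - int_h int_x (u(x + h) - u(x)) zeta(x),
    where h ranges over the cell. *)
Lemma pairing_bound (l : R) zeta : 0 < l ->
  bounded_measurable zeta -> torus_periodic L zeta ->
  \int[vol]_x zeta x = 0 ->
  `|\int[vol]_x (u x * zeta x)| <=
  \sum_(i < d) L *
    (l / 2 * \int[vol]_x (G i x ^+ 2) + (\int[vol]_x (zeta x ^+ 2)) / (2 * l)).
Proof.
move=> l0 bz pz z0; set C := (X in _ <= X).
pose F (z : 'rV[R]_d * 'rV[R]_d) := (u (z.1 + z.2) - u z.2) * zeta z.2.
have i2 : intg2 vol vol F.
  have [mu [M uM]] := bu; have [mz [N zN]] := bz.
  apply: intg2_bounded.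
    apply: measurable_funM; last exact: (measurableT_comp mz measurable_snd).
    apply: measurable_funB; first exact: (measurableT_comp mu measurable_sum).
    exact: (measurableT_comp mu measurable_snd).
  exists ((M + M) * N) => z; rewrite normrM ler_pM//.
  by rewrite (le_trans (ler_normB _ _))// lerD.
have [Ei _ _ EF] := Rfubini i2.
have E0 : \int[vol]_y \int[vol]_x F (y, x) = - (L ^+ d * \int[vol]_x (u x * zeta x)).
  rewrite EF.
  transitivity (\int[vol]_y (\int[vol]_x u x * zeta y - L ^+ d * (u y * zeta y))).
    apply: eq_Rintegral => y _; rewrite /F /=.
    rewrite RintegralZr//; last first.
      apply/bounded_measurable_intg/bounded_measurableB; first exact: bounded_measurable_shift.
      exact: bounded_measurable_cst.
    rewrite RintegralB//; last 2 first.
    - by apply/bounded_measurable_intg/bounded_measurable_shift.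
    - exact: intg_cst.
    rewrite (Rtorus_shift L0 _ bu.1 pu) Rintegral_cst// volT//.
    by rewrite mulrBl (mulrC (u y)) mulrA.
  rewrite RintegralB//; last 2 first.
  - by apply: intgZ; exact: bounded_measurable_intg.
  - by apply/intgZ/bounded_measurable_intg/bounded_measurableM.
  rewrite !RintegralZl//; last 2 first.
  - exact: bounded_measurable_intg.
  - by apply/bounded_measurable_intg/bounded_measurableM.
  by rewrite z0 mulr0 sub0r.
have Ld0 : 0 < L ^+ d by rewrite exprn_gt0.
rewrite -(ler_pM2l Ld0) -{1}(gtr0_norm Ld0) -normrM -normrN -E0.
rewrite (le_trans (le_normr_Rintegral measurableT Ei))//.
rewrite -(@volT _ d _ L0) mulrC -Rintegral_cst//.
apply: intg_ae_le; [exact: intg_norm|exact: intg_cst|].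
apply: filterS (ae_open_cell d L0) => h hL.
have hL' i : 0 <= h ord0 i <= L by have /andP[/ltW -> /ltW ->] := hL i.
have := translation_bound (index_enum 'I_d) l0 hL' bz pz.
rewrite -row_sum_delta => tb; rewrite /F /=.
by under eq_Rintegral do rewrite (addrC h).
Qed.

End increments.

(** * Convolution with the interaction potential *)

Section convolution_derivative.
Context {R : realType} {d : nat}.
Variable L : R.
Hypothesis L0 : 0 < L.
Implicit Types (x h : 'rV[R]_d) (sigma : 'rV[R]_d -> R).

Local Notation vol := (torus_measure L d).
Local Notation e_ i := (delta_mx ord0 i : 'rV[R]_d).

Lemma measurable_diff : measurable_fun setT (fun z : 'rV[R]_d * 'rV[R]_d => z.1 - z.2).
Proof.
apply: measurable_fun_rV => j.
have m1 := measurableT_comp (@measurable_coord R d j) (@measurable_fst _ _ 'rV[R]_d 'rV[R]_d).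
have m2 := measurableT_comp (@measurable_coord R d j) (@measurable_snd _ _ 'rV[R]_d 'rV[R]_d).
by apply: eq_measurable_fun (measurable_funB m1 m2) => z _; rewrite /= !mxE.
Qed.

Lemma measurable_reflect x : measurable_fun setT (fun y : 'rV[R]_d => x - y).
Proof. exact: (measurableT_comp measurable_diff (pair1_measurable x)). Qed.

Lemma bounded_measurable_reflect (V : 'rV[R]_d -> R) x :
  bounded_measurable V -> bounded_measurable (fun y : 'rV[R]_d => V (x - y)).
Proof.
move=> [mV [M VM]]; split; last by exists M.
exact: (measurableT_comp mV (measurable_reflect x)).
Qed.

Lemma convolution_intg2 (V sigma : 'rV[R]_d -> R) :
  bounded_measurable V -> intg vol sigma ->
  intg2 vol vol (fun z : 'rV[R]_d * 'rV[R]_d => V (z.1 - z.2) * sigma z.2).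
Proof.
move=> [mV [M VM]] si; have ms := intg_measurable si.
suff : intg2 vol vol (fun z : 'rV[R]_d * 'rV[R]_d => V (z.2 - z.1) * sigma z.1).
  exact: intg2_swap.
apply: (@intg2_dominated1 _ _ _ _ _ _ _ _ (fun x => M * `|sigma x|)).
- apply: measurable_funM; last exact: (measurableT_comp ms measurable_fst).
  have m21 : measurable_fun setT (fun z : 'rV[R]_d * 'rV[R]_d => (z.2, z.1)).
    exact: measurable_fun_pair.
  exact: (measurableT_comp mV (measurableT_comp measurable_diff m21)).
- by move=> z; rewrite normrM ler_wpM2r.
- exact/intgZ/intg_norm.
Qed.

Lemma convolution_bounded_measurable (V sigma : 'rV[R]_d -> R) (M : R) :
  measurable_fun setT V -> (forall x, `|V x| <= M) -> intg vol sigma ->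
  measurable_fun setT (convolution L V sigma) /\
  forall x, `|convolution L V sigma x| <= M * \int[vol]_y `|sigma y|.
Proof.
move=> mV VM si; have bV : bounded_measurable V by split => //; exists M.
split.
  by have [Ii _ _ _] := Rfubini (convolution_intg2 bV si); exact: intg_measurable Ii.
move=> x; rewrite /convolution.
have ip : intg vol (fun y => V (x - y) * sigma y).
  under eq_fun do rewrite mulrC.
  exact: (intg_mul si (bounded_measurable_reflect x bV)).
rewrite (le_trans (le_normr_Rintegral measurableT ip))//.
rewrite -RintegralZl//; last exact: intg_norm.
apply: le_Rintegral => //; first exact: intg_norm.
- exact/intgZ/intg_norm.
- by move=> y _; rewrite normrM ler_wpM2r.
Qed.

Variable W : 'rV[R]_d -> R.
Hypothesis pW : torus_periodic L W.
Hypothesis kW : Ck 2 W.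

Lemma W_bounded_measurable : bounded_measurable W.
Proof. exact: (periodic_continuous_bounded_measurable L0 pW (Ck_continuous kW)). Qed.

Lemma dW_continuous i : continuous (partial_derive i W).
Proof. by have [_ /(_ i)[_ []]] := kW. Qed.

Lemma dW_bounded_measurable i : bounded_measurable (partial_derive i W).
Proof.
apply: (periodic_continuous_bounded_measurable L0); last exact: dW_continuous.
exact: partial_derive_periodic.
Qed.

(** Differentiation under the integral sign, along the line through x in the
    direction i. *)
Lemma partial_derive_convolution i sigma x : bounded_measurable sigma ->
  partial_derive i (convolution L W sigma) x =
  convolution L (partial_derive i W) sigma x.
Proof.
move=> bs.
have bdW := dW_bounded_measurable i.
have [_ [M WM]] := bdW.
have dW : forall y, derivable W y (e_ i) by have [_ /(_ i)[]] := kW.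
pose f (t : R) y := W ((x - y) + t *: e_ i) * sigma y.
have df y (t : R) : is_derive t 1 (f ^~ y) (partial_derive i W ((x - y) + t *: e_ i) * sigma y).
  have dl := is_derive_line (x := x - y) (t := t) (dW ((x - y) + t *: e_ i)).
  apply: (@is_derive_eq _ _ _ _ _ _ _ _ (is_deriveM dl (is_derive_cst (sigma y) t 1))).
  by rewrite scaler0 add0r -[_ *: _]/(_ * _) mulrC.
have d1f (t : R) y : partial1of2 f t y = partial_derive i W ((x - y) + t *: e_ i) * sigma y.
  by rewrite partial1of2E; have := df y t => ?; rewrite derive_val.
have fi t : intg vol (f t).
  apply/bounded_measurable_intg/bounded_measurableM => //.
  have := bounded_measurable_reflect (x + t *: e_ i) W_bounded_measurable.
  by under eq_fun do rewrite addrAC.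
pose g y := M * `|sigma y|.
have M0 : 0 <= M by exact: le_trans (WM 0).
have gi : intg vol g by exact/intgZ/intg_norm/bounded_measurable_intg.
have g0 y : 0 <= g y by rewrite mulr_ge0.
have I0 : `]-1, 1[%classic (0 : R) by rewrite /= in_itv/= ltrN10 ltr01.
have dft (t : R) y : `]-1, 1[%classic t -> setT y -> derivable (f ^~ y) t 1.
  by move=> _ _; have [] := df y t.
have fg (t : R) y : `]-1, 1[%classic t -> setT y -> `|partial1of2 f t y| <= g y.
  by move=> _ _; rewrite d1f normrM ler_wpM2r.
have D1 := derivable_under_integral measurableT I0 (fun t _ => fi t) dft g0 gi fg.
have D2 := differentiation_under_integral measurableT I0 (fun t _ => fi t) dft g0 gi fg.
have H : is_derive (0 : R) 1 (fun s => convolution L W sigma (x + s *: e_ i))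
    (convolution L (partial_derive i W) sigma x).
  have E : (fun s => convolution L W sigma (x + s *: e_ i)) =
      (fun t => \int[vol]_(y in setT) f t y).
    apply/funext => s; rewrite /convolution /f.
    by apply: eq_Rintegral => y _; rewrite addrAC.
  rewrite E; apply: DeriveDef => //.
  rewrite -derive1E D2 /convolution; apply: eq_Rintegral => y _.
  by rewrite d1f scale0r addr0.
by have := is_derive_of_line H => ?; rewrite /partial_derive derive_val.
Qed.

End convolution_derivative.

Section stationary.
Context {R : realType} {d : nat}.
Variable L : R.
Hypothesis L0 : 0 < L.
Implicit Types (x h : 'rV[R]_d).

Local Notation vol := (torus_measure L d).
Local Notation e_ i := (delta_mx ord0 i : 'rV[R]_d).
Local Notation a := (rho_infty d L).

(** Averaging over all translations by t e_i, 0 <= t < L, does not change the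
    integral; for fixed x the average is proportional to the increment of phi over a
    period. *)
Lemma integral_partial_derive0 i (phi : 'rV[R]_d -> R) : test_function L phi ->
  \int[vol]_x partial_derive i phi x = 0.
Proof.
move=> tphi; have [pphi kphi] := tphi.
have [cphi /(_ i)[dphi [cdphi _]]] := kphi 1%N.
have pdphi := partial_derive_periodic i pphi.
have bdphi := periodic_continuous_bounded_measurable L0 pdphi cdphi.
have i2 : intg2 (circle_measure L) vol (fun z : measurableTypeR R * 'rV[R]_d =>
    partial_derive i phi (z.2 + (1 * z.1) *: e_ i)).
  apply: intg2_bounded; first exact: (measurableT_comp bdphi.1 (measurable_ray _ _)).
  by have [_ [M HM]] := bdphi; exists M.
have [_ _ _ E] := Rfubini i2.
have : L * \int[vol]_x partial_derive i phi x = 0.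
  transitivity (\int[circle_measure L]_t \int[vol]_x partial_derive i phi x).
    by rewrite Rintegral_cst// circle_measureT ?ltW// mulrC.
  transitivity (\int[circle_measure L]_t \int[vol]_x
      partial_derive i phi (x + (1 * t) *: e_ i)).
    by apply: eq_Rintegral => t _; rewrite Rtorus_shift//; exact: bdphi.1.
  rewrite E; transitivity (\int[vol]_x (0 : R)); last by rewrite Rintegral_cst// mul0r.
  apply: eq_Rintegral => x _; under eq_Rintegral do rewrite /= mul1r.
  by rewrite integral_partial_derive ?ltW// pphi subrr.
by move/eqP; rewrite mulf_eq0 gt_eqF//= => /eqP.
Qed.

Variable W : 'rV[R]_d -> R.
Hypothesis pW : torus_periodic L W.
Hypothesis kW : Ck 2 W.
Hypothesis eW : coordinatewise_even W.
Hypothesis W0 : \int[vol]_x W x = 0.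

(** Reversing the sign of the coordinates one after the other. *)
Lemma W_even x : W (- x) = W x.
Proof.
pose flips (s : seq 'I_d) := foldr (@flip_coord R d) x s.
have Wf s : W (flips s) = W x by elim: s => //= i s IHs; rewrite eW.
have fE s : uniq s -> forall j, flips s ord0 j = (if j \in s then - x ord0 j else x ord0 j).
  elim: s => [//|i s IHs] /= /andP[ins us] j; rewrite mxE IHs// in_cons.
  by have [->|_] := eqVneq j i; rewrite /= ?(negPf ins).
rewrite -(Wf (index_enum 'I_d)); congr W; apply/rowP => j.
by rewrite fE ?index_enum_uniq// mem_index_enum mxE.
Qed.

Lemma integral_W_reflect x : \int[vol]_y W (x - y) = 0.
Proof.
transitivity (\int[vol]_y W (y + - x)).
  by apply: eq_Rintegral => y _; rewrite -W_even opprB.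
by rewrite Rtorus_shift//; exact: (W_bounded_measurable L0 pW kW).1.
Qed.

Lemma convolution_W_cst (c : R) : convolution L W (cst c) = cst 0.
Proof.
apply/funext => x; rewrite /convolution.
rewrite RintegralZr// ?integral_W_reflect ?mul0r//.
by apply/bounded_measurable_intg/bounded_measurable_reflect; exact: (W_bounded_measurable L0 pW kW).
Qed.

(** Both terms of the flux vanish: the gradient of a constant, and the gradient of
    the convolution of W with a constant. *)
Lemma constant_stationary (m beta : R) : stationary_solution L W m beta (cst a).
Proof.
split.
- split => //.
  + by move=> x; rewrite ltW// rho_infty_gt0.
  + apply: etrans (integral_cst vol measurableT a%:E) _.
    rewrite [X in (_ * X)%E]torus_measureT ?ltW// -EFinM rho_inftyM//.
- exact: Lfun_cst.
- by exists `|a|.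
- exists (fun _ => cst 0).
  + split => //.
    * exact: (Lfun_cst _ (a `^ m)).
    * by move=> i; exact: Lfun_cst.
    * move=> i phi tphi; under [in RHS]eq_Rintegral do rewrite mul0r.
      rewrite Rintegral_cst// mul0r oppr0 /cst RintegralZl//.
        by rewrite integral_partial_derive0// mulr0.
      have [pphi kphi] := tphi.
      have [_ /(_ i)[_ [cdphi _]]] := kphi 1%N.
      apply/bounded_measurable_intg.
      apply: (periodic_continuous_bounded_measurable L0) => //.
      exact: partial_derive_periodic.
  + move=> phi Phi _; rewrite convolution_W_cst.
    transitivity (\int[vol]_x (0 : R)); last by rewrite Rintegral_cst// mul0r.
    apply: eq_Rintegral => x _; apply: big1 => i _.
    by rewrite /partial_derive derive_cst !mulr0 addr0 mul0r.
Qed.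

End stationary.

(** * Strict convexity of powers *)

Section powers.
Context {R : realType}.

(** Write r^m = r r^(m-1).  As r^(m-1) is nondecreasing, the difference of the two
    sides is r times a product of two factors of the same sign. *)
Lemma powR_monotone_gap (m r b : R) : 1 < m -> 0 <= r -> 0 < b ->
  b `^ (m - 1) * (r - b) ^+ 2 <= (r `^ m - b `^ m) * (r - b).
Proof.
move=> m1 r0 b0; have m0 : 0 < m by lra.
rewrite -(mulr_powRB1 r0 m0) -(mulr_powRB1 (ltW b0) m0).
have [rb|br] := leP r b.
  have : r `^ (m - 1) <= b `^ (m - 1).
    by rewrite ge0_ler_powR ?nnegrE// ?ltW//; lra.
  move: (r `^ _) (b `^ _) => p q pq.
  have := mulr_ge0 (mulr_ge0 r0 (_ : 0 <= q - p)) (_ : 0 <= b - r).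
  by rewrite !subr_ge0 => /(_ pq rb); lra.
have : b `^ (m - 1) <= r `^ (m - 1).
  by rewrite ge0_ler_powR ?nnegrE// ?ltW//; lra.
move: (r `^ _) (b `^ _) => p q pq.
have := mulr_ge0 (mulr_ge0 r0 (_ : 0 <= p - q)) (_ : 0 <= r - b).
by rewrite !subr_ge0 => /(_ pq (ltW br)); lra.
Qed.

(** With q = r^(1/2), exp y >= 1 + y gives ln r >= 2 (1 - 1 / q) and then
    r^(m-1) >= 1 + (m-1) ln r, so the right-hand side is at least
    (m-1) (q-1)^2; finally (q^2-1)^2 <= 2 (q^2+1) (q-1)^2. *)
Lemma powR_convexity_gap1 (m r : R) : 1 < m -> 0 <= r ->
  (m - 1) * ((r - 1) ^+ 2 / (2 * (r + 1))) <= r `^ m - 1 - m * (r - 1).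
Proof.
move=> m1 r0; have m0 : 0 < m by lra.
move: r0; rewrite le_eqVlt => /predU1P[<-|r0].
  by rewrite powR0 ?gt_eqF// !sub0r add0r sqrrN expr1n mulr1; lra.
pose q := Num.sqrt r.
have q0 : 0 < q by rewrite sqrtr_gt0.
have qr : r = q ^+ 2 by rewrite sqr_sqrtr// ltW.
have lnq : 2 * (1 - q^-1) <= ln r.
  have lq : expR (- ln q) = q^-1 by rewrite expRN lnK.
  have := expR_ge1Dx (- ln q); rewrite lq qr lnXn// -mulr_natl; lra.
have pr : r * (1 + (m - 1) * (2 * (1 - q^-1))) <= r `^ m.
  rewrite -(mulr_powRB1 (ltW r0) m0) ler_wpM2l ?(ltW r0)//.
  rewrite /powR gt_eqF//; apply: le_trans (expR_ge1Dx _).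
  by rewrite lerD2l ler_wpM2l//; lra.
have e1 : r * (1 + (m - 1) * (2 * (1 - q^-1))) - 1 - m * (r - 1) = (m - 1) * (q - 1) ^+ 2.
  by rewrite qr; field; rewrite gt_eqF.
apply: (@le_trans _ _ ((m - 1) * (q - 1) ^+ 2)); last by rewrite -e1; lra.
rewrite ler_wpM2l//; first lra.
have q2 : 0 < q ^+ 2 by rewrite exprn_gt0.
rewrite ler_pdivrMr; last by rewrite qr; lra.
rewrite -subr_ge0 qr.
have -> : (q - 1) ^+ 2 * (2 * (q ^+ 2 + 1)) - (q ^+ 2 - 1) ^+ 2 = ((q - 1) ^+ 2) ^+ 2 by ring.
exact: sqr_ge0.
Qed.

(** Scaling the previous inequality by b gives a multiple
    of (r-b)^2 / (r+b), and z^2 / w >= 2 t z - t^2 w for every t.  The parameter t is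
    chosen only after integration, when it may depend on integrals of r. *)
Lemma powR_convexity_gap (m r b t : R) : 1 < m -> 0 <= r -> 0 < b ->
  (m - 1) * b `^ (m - 1) / 2 * (2 * t * `|r - b| - t ^+ 2 * (r + b)) <=
  r `^ m - b `^ m - m * b `^ (m - 1) * (r - b).
Proof.
move=> m1 r0 b0; have m0 : 0 < m by lra.
have rb0 : 0 < r + b by lra.
pose s := r / b.
have s0 : 0 <= s by rewrite divr_ge0// ltW.
have rE : r = b * s by rewrite /s mulrC divfK// gt_eqF.
have := powR_convexity_gap1 m1 s0.
have c0 : 0 < b `^ (m - 1) by exact: powR_gt0.
have bm : b `^ m = b * b `^ (m - 1) by rewrite mulr_powRB1// ltW.
have -> : r `^ m = b `^ m * s `^ m by rewrite rE powRM// ltW.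
have bc0 : 0 < b * b `^ (m - 1) by exact: mulr_gt0.
rewrite -(ler_pM2l bc0) bm => H.
have -> : b * b `^ (m - 1) * s `^ m - b * b `^ (m - 1) - m * b `^ (m - 1) * (r - b) =
   b * b `^ (m - 1) * (s `^ m - 1 - m * (s - 1)) by rewrite rE; ring.
apply: le_trans H.
have s1 : 0 < s + 1 by lra.
have -> : b * b `^ (m - 1) * ((m - 1) * ((s - 1) ^+ 2 / (2 * (s + 1)))) =
  (m - 1) * b `^ (m - 1) / 2 * ((r - b) ^+ 2 / (r + b)).
  rewrite rE; field.
  by rewrite -rE !gt_eqF.
rewrite ler_wpM2l//; first by rewrite divr_ge0// mulr_ge0 ?(ltW c0)//; lra.
rewrite ler_pdivlMr// -(real_normK (num_real (r - b))) -subr_ge0.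
have -> : `|r - b| ^+ 2 - (2 * t * `|r - b| - t ^+ 2 * (r + b)) * (r + b) =
  (`|r - b| - t * (r + b)) ^+ 2 by ring.
exact: sqr_ge0.
Qed.

End powers.

(** * Uniqueness of the stationary solution *)

Section uniqueness.
Context {R : realType} {d : nat}.
Variable L : R.
Hypothesis L0 : 0 < L.
Implicit Types (x h : 'rV[R]_d).

Local Notation vol := (torus_measure L d).
Local Notation a := (rho_infty d L).

(** The integral of (|f| - k)^2 is nonnegative; k is the mean of |f|. *)
Lemma Rintegral_abs_sqr (f : 'rV[R]_d -> R) : bounded_measurable f ->
  (\int[vol]_x `|f x|) ^+ 2 <= L ^+ d * \int[vol]_x (f x ^+ 2).
Proof.
move=> bf; set T := \int[vol]_x _; set D := \int[vol]_x _.
have Ld0 : 0 < L ^+ d by rewrite exprn_gt0.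
have fa := bounded_measurable_norm bf.
have T0 : 0 <= T by apply: Rintegral_ge0.
have D0 : 0 <= D by apply: Rintegral_ge0 => x _; exact: sqr_ge0.
pose k := T / L ^+ d.
have f2 : intg vol (fun x => f x ^+ 2).
  by apply: bounded_measurable_intg; exact: bounded_measurableM.
have H : 0 <= D - (2 * k * T - k ^+ 2 * L ^+ d).
  have -> : D - (2 * k * T - k ^+ 2 * L ^+ d) = \int[vol]_x ((`|f x| - k) ^+ 2).
    transitivity (\int[vol]_x (f x ^+ 2 - (2 * k * `|f x| - k ^+ 2))); last first.
      apply: eq_Rintegral => x _; rewrite -(real_normK (num_real (f x))); ring.
    have i1 := intgZ (2 * k) (bounded_measurable_intg vol fa).
    have i2 := intg_cst vol (k ^+ 2).
    rewrite RintegralB//; last exact: intgB.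
    rewrite RintegralB// Rintegral_cst// volT// RintegralZl//.
    exact: bounded_measurable_intg.
  by apply: Rintegral_ge0 => x _; exact: sqr_ge0.
have kE : k * L ^+ d = T by rewrite /k divfK// gt_eqF.
have kk : k ^+ 2 * L ^+ d = k * T by rewrite expr2 -mulrA kE.
have {}H : k * T <= D by rewrite kk in H; lra.
by rewrite expr2 -{1}kE mulrAC [leRHS]mulrC ler_wpM2r// ltW.
Qed.

Variable W : 'rV[R]_d -> R.
Hypothesis pW : torus_periodic L W.
Hypothesis kW : Ck 2 W.
Hypothesis eW : coordinatewise_even W.
Hypothesis W0 : \int[vol]_x W x = 0.

(** The constant C in the bound D <= C beta^2 D: the product of the constants of
    the Poincare inequality and of the drift estimate. *)
Definition stationary_gap (M m : R) : R :=
  d%:R * L ^+ 2 / (a `^ (m - 1)) ^+ 2 * (2 * (d%:R * M ^+ 2)).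

(** The boundedness of rho makes u and its pairings with bounded functions
    integrable, but the size of rho does not enter the constant. *)
Lemma stationary_estimate (m beta M : R) (rho : 'rV[R]_d -> R) :
  (0 < d)%N -> 1 < m -> 0 < beta ->
  (forall i x, `|partial_derive i W x| <= M) ->
  stationary_solution L W m beta rho ->
  intg vol (fun x => (rho x - a) ^+ 2) /\
  \int[vol]_x ((rho x - a) ^+ 2) <=
  stationary_gap M m * beta ^+ 2 * \int[vol]_x ((rho x - a) ^+ 2).
Proof.
move=> d0 m1 beta0 WM [[prho mrho rho0 rho1] _ [N rhoN] [G [pu uL pG GL uG] eqn]].
have a0 := @rho_infty_gt0 _ d _ L0.
have brho : bounded_measurable rho by split => //; exists N.
pose u x := rho x `^ m.
have m0 : 0 < m by lra.
have bu : bounded_measurable u.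
  split; first exact: (measurableT_comp (measurable_powR m) mrho).
  exists (N `^ m) => x; rewrite ger0_norm ?powR_ge0//.
  have rN := rhoN x; rewrite ger0_norm// in rN.
  by rewrite ge0_ler_powR ?nnegrE ?(ltW m0)// (le_trans (rho0 x) rN).
have Gi i : intg vol (G i).
  apply/Lfun1_integrable; apply: Lfun_subset12 (GL i).
  exact: fin_num_measure.
have G2 i : intg vol (fun x => G i x ^+ 2) by exact: Lfun2_integrable_sqr.
pose s x := rho x - a.
have bs : bounded_measurable s.
  by apply: bounded_measurableB => //; exact: bounded_measurable_cst.
have ps : torus_periodic L s by move=> i x; rewrite /s prho.
have s2 : intg vol (fun x => s x ^+ 2).
  by apply: bounded_measurable_intg; exact: bounded_measurableM.
split=> //.
set D := \int[vol]_x _.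
have D0 : 0 <= D by apply: Rintegral_ge0 => x _; exact: sqr_ge0.
have rhoI : \int[vol]_x rho x = 1 by rewrite /Rintegral rho1.
have sI : \int[vol]_x s x = 0.
  rewrite RintegralB//; last 2 first.
  - exact: bounded_measurable_intg.
  - exact: intg_cst.
  by rewrite rhoI Rintegral_cst// volT// rho_inftyM// subrr.
pose c := a `^ (m - 1).
have c0 : 0 < c by exact: powR_gt0.
pose S := \sum_(i < d) \int[vol]_x (G i x ^+ 2).
have dR : 0 < d%:R :> R by rewrite ltr0n.
(* Strong monotonicity bounds D by the pairing of u with s. *)
have est1 : D <= d%:R * L ^+ 2 / c ^+ 2 * S.
  have c1 : c * D <= \int[vol]_x (u x * s x).
    have -> : \int[vol]_x (u x * s x) = \int[vol]_x ((u x - a `^ m) * s x).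
      under [RHS]eq_Rintegral do rewrite mulrBl.
      rewrite RintegralB//; last 2 first.
      - by apply: bounded_measurable_intg; exact: bounded_measurableM.
      - by apply: intgZ; exact: bounded_measurable_intg.
      rewrite [X in _ - X]RintegralZl//; last exact: bounded_measurable_intg.
      by rewrite sI mulr0 subr0.
    rewrite /D -RintegralZl//; apply: le_Rintegral => //.
    - exact: intgZ.
    - apply: bounded_measurable_intg; apply: bounded_measurableM => //.
      by apply: bounded_measurableB => //; exact: bounded_measurable_cst.
    - by move=> x _; exact: powR_monotone_gap.
  (* This weight makes the term in D of the pairing bound equal to c D / 2, to be
     absorbed. *)
  pose l := d%:R * L / c.
  have l0 : 0 < l by rewrite divr_gt0// mulr_gt0.
  have := pairing_bound L0 bu pu pG Gi G2 uG l0 bs ps sI.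
  rewrite -mulr_sumr big_split/= -mulr_sumr sumr_const card_ord -/S -/D => pb.
  have {}pb : c * D <= L * (l / 2 * S + D / (2 * l) *+ d).
    by rewrite (le_trans c1)// (le_trans (ler_norm _)).
  have E1 : L * (D / (2 * l) *+ d) = c * D / 2.
    by rewrite -mulr_natr /l; field; rewrite !gt_eqF.
  have E2 : L * (l / 2 * S) = (d%:R * L ^+ 2 / c ^+ 2 * S) * c / 2.
    by rewrite /l; field; rewrite !gt_eqF.
  rewrite -(ler_pM2r c0); move: pb; rewrite mulrDr E1 E2; lra.
(* The drift term; B i is the i-th partial derivative of W * rho. *)
pose B i := partial_derive i (convolution L W rho).
have BE i x : B i x = convolution L (partial_derive i W) rho x.
  exact: partial_derive_convolution.
have BEs i x : B i x = convolution L (partial_derive i W) s x.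
  rewrite -(partial_derive_convolution L0 pW kW)//; congr (partial_derive i _ x).
  apply/funext => y; rewrite /convolution.
  under [RHS]eq_Rintegral do rewrite mulrBr.
  have bV := bounded_measurable_reflect y (W_bounded_measurable L0 pW kW).
  rewrite RintegralB//; last 2 first.
  - by apply: bounded_measurable_intg; exact: bounded_measurableM.
  - apply: bounded_measurable_intg; apply: bounded_measurableM => //.
    exact: bounded_measurable_cst.
  have := convolution_W_cst L0 pW kW eW W0 a => /(congr1 (fun f => f y)) /= E.
  by rewrite [X in _ - X]E subr0.
have mdW i := (dW_bounded_measurable L0 pW kW i).1.
have M0 : 0 <= M by exact: le_trans (WM (Ordinal d0) 0).
have [bB BM] : (forall i, bounded_measurable (B i)) /\
    forall i x, B i x ^+ 2 <= M ^+ 2 /\ B i x ^+ 2 <= M ^+ 2 * (L ^+ d * D).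
  have H i := convolution_bounded_measurable (mdW i) (WM i) (bounded_measurable_intg vol brho).
  have Hs i := convolution_bounded_measurable (mdW i) (WM i) (bounded_measurable_intg vol bs).
  have rI : \int[vol]_y `|rho y| = 1.
    by rewrite -rhoI; apply: eq_Rintegral => x _; rewrite ger0_norm.
  split.
    move=> i; rewrite (_ : B i = convolution L (partial_derive i W) rho); last exact/funext.
    split; first exact: (H i).1.
    by exists (M * \int[vol]_y `|rho y|); exact: (H i).2.
  move=> i x; rewrite -(real_normK (num_real (B i x))); split.
    rewrite lerXn2r ?nnegrE// BE.
    by have := (H i).2 x; rewrite rI mulr1.
  apply: (@le_trans _ _ ((M * \int[vol]_y `|s y|) ^+ 2)).
    rewrite lerXn2r ?nnegrE//; first by rewrite mulr_ge0// Rintegral_ge0.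
    by rewrite BEs; exact: (Hs i).2.
  by rewrite exprMn ler_wpM2l ?sqr_ge0//; exact: Rintegral_abs_sqr.
have rho2 : \int[vol]_x (rho x ^+ 2) = D + a.
  transitivity (\int[vol]_x (s x ^+ 2 + (2 * a * s x + a ^+ 2))).
    by apply: eq_Rintegral => x _; rewrite /s; ring.
  have i1 := intgZ (2 * a) (bounded_measurable_intg vol bs).
  have i2 := intg_cst vol (a ^+ 2).
  rewrite RintegralD//; last exact: intgD.
  rewrite RintegralD// Rintegral_cst// volT// RintegralZl//; last exact: bounded_measurable_intg.
  by rewrite sI mulr0 add0r expr2 -mulrA rho_inftyM// mulr1.
have brB i : bounded_measurable (fun x => rho x * B i x) by exact: bounded_measurableM.
have irB i : intg vol (fun x => (rho x * B i x) ^+ 2).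
  by apply: bounded_measurable_intg; exact: bounded_measurableM.
have rB i : \int[vol]_x ((rho x * B i x) ^+ 2) <= 2 * M ^+ 2 * D.
  have key k : 0 <= k -> (forall x, B i x ^+ 2 <= k) ->
      \int[vol]_x ((rho x * B i x) ^+ 2) <= k * (D + a).
    move=> k0 Bk; rewrite -rho2.
    have r2 : intg vol (fun x => rho x ^+ 2).
      by apply: bounded_measurable_intg; exact: bounded_measurableM.
    rewrite -RintegralZl//; apply: le_Rintegral => //; [exact: irB|exact: intgZ|].
    by move=> x _; rewrite exprMn mulrC ler_wpM2r ?sqr_ge0.
  (* In the first case D + a <= 2 a and L^d a = 1, in the second D + a <= 2 D. *)
  have [Da|aD] := leP D a.
    have k0 : 0 <= M ^+ 2 * (L ^+ d * D).
      by rewrite mulr_ge0 ?sqr_ge0// mulr_ge0// exprn_ge0// ltW.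
    apply: le_trans (key _ k0 (fun x => (BM i x).2)) _.
    have -> : 2 * M ^+ 2 * D = M ^+ 2 * (L ^+ d * D) * (a + a).
      have := @rho_inftyM _ d _ L0 => aL.
      transitivity (2 * M ^+ 2 * D * (a * L ^+ d)); last by ring.
      by rewrite aL mulr1.
    by rewrite ler_wpM2l// lerD2r.
  apply: le_trans (key _ (sqr_ge0 M) (fun x => (BM i x).1)) _.
  have := mulr_ge0 (sqr_ge0 M) (_ : 0 <= D - a); rewrite subr_ge0 => /(_ (ltW aD)).
  lra.
have est2 : S <= beta ^+ 2 * (2 * (d%:R * M ^+ 2)) * D.
  have uH : H1_with_gradient L u G by split.
  have := eqn _ _ (_ : H1_with_gradient L u G) => /(_ uH) E.
  (* Completing the square in the equation tested against u. *)
  pose lower x := \sum_(i < d)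
    (beta^-1 / 2 * G i x ^+ 2 - beta / 2 * (rho x * B i x) ^+ 2).
  have lowi i : intg vol (fun x => beta^-1 / 2 * G i x ^+ 2 - beta / 2 * (rho x * B i x) ^+ 2).
    by apply: intgB; [exact: (intgZ _ (G2 i))|exact: (intgZ _ (irB i))].
  have : \int[vol]_x lower x <= 0.
    rewrite -E; apply: le_Rintegral => //.
    - exact: intg_sum.
    - apply: intg_sum => i; under eq_fun do rewrite mulrDl -mulrA -expr2.
      apply: intgD; first exact: (intgZ _ (G2 i)).
      by under eq_fun do rewrite mulrC; exact: (intg_mul (Gi i) (brB i)).
    - move=> x _; apply: ler_sum => i _.
      rewrite -[partial_derive i _ x]/(B i x); set g := G i x; set b := rho x * B i x.
      rewrite -subr_ge0.
      have -> : (beta^-1 * g + b) * g - (beta^-1 / 2 * g ^+ 2 - beta / 2 * b ^+ 2) =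
          (g + beta * b) ^+ 2 / (2 * beta) by field; rewrite gt_eqF.
      by rewrite divr_ge0 ?sqr_ge0// mulr_ge0// ltW.
  rewrite Rintegral_sum//.
  have -> : \sum_(i < d) \int[vol]_x
      (beta^-1 / 2 * G i x ^+ 2 - beta / 2 * (rho x * B i x) ^+ 2) =
      beta^-1 / 2 * S - beta / 2 * \sum_(i < d) \int[vol]_x ((rho x * B i x) ^+ 2).
    rewrite /S !mulr_sumr -sumrB; apply: eq_bigr => i _.
    rewrite RintegralB//; last 2 first.
    - exact: (intgZ _ (G2 i)).
    - exact: (intgZ _ (irB i)).
    by rewrite !RintegralZl//; [exact: G2|exact: irB].
  have : \sum_(i < d) \int[vol]_x ((rho x * B i x) ^+ 2) <= d%:R * (2 * M ^+ 2 * D).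
    rewrite (le_trans (ler_sum _ (fun i _ => rB i)))//.
    by rewrite sumr_const card_ord -[leLHS]mulr_natl.
  set Q := \sum_(i < d) _ => Qle.
  rewrite subr_le0 => H.
  have {}H : S <= beta ^+ 2 * Q.
    have -> : S = (beta^-1 / 2 * S) * (2 * beta) by field; rewrite gt_eqF.
    have -> : beta ^+ 2 * Q = (beta / 2 * Q) * (2 * beta) by field.
    by rewrite ler_wpM2r// mulr_ge0// ltW.
  rewrite (le_trans H)//.
  have -> : beta ^+ 2 * (2 * (d%:R * M ^+ 2)) * D = beta ^+ 2 * (d%:R * (2 * M ^+ 2 * D)) by ring.
  by rewrite ler_wpM2l// sqr_ge0.
rewrite (le_trans est1)// /stationary_gap -/c.
set K := _ / c ^+ 2.
have -> : K * (2 * (d%:R * M ^+ 2)) * beta ^+ 2 * D = K * (beta ^+ 2 * (2 * (d%:R * M ^+ 2)) * D) by ring.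
rewrite ler_wpM2l// /K divr_ge0 ?sqr_ge0// mulr_ge0 ?sqr_ge0//.
Qed.

(** Any beta1 with (C + 1) beta1 <= 1 makes C beta^2 < 1, and then D <= C beta^2 D
    leaves only D = 0. *)
Lemma stationary_unique (m : R) : (0 < d)%N -> 1 < m ->
  exists2 beta1 : R, 0 < beta1 & forall beta rho, 0 < beta -> beta < beta1 ->
    stationary_solution L W m beta rho -> ae_eq vol setT rho (cst a).
Proof.
move=> d0 m1.
have [M WM] : exists M, forall i x, `|partial_derive i W x| <= M.
  have /choice[N HN] : forall i, exists N, forall x, `|partial_derive i W x| <= N.
    by move=> i; have [_] := dW_bounded_measurable L0 pW kW i.
  exists (\sum_i `|N i|) => i x; rewrite (le_trans (HN i x))//.
  by rewrite (bigD1 i)//= (le_trans (ler_norm _))// lerDl sumr_ge0.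
pose K := stationary_gap M m.
have K0 : 0 <= K.
  apply: mulr_ge0; last by apply: mulr_ge0 => //; apply: mulr_ge0 => //; exact: sqr_ge0.
  by apply: divr_ge0; [apply: mulr_ge0 => //|]; exact: sqr_ge0.
exists ((K + 1)^-1); first by rewrite invr_gt0 ltr_wpDl.
move=> beta rho beta0 betaK st.
have [s2 est] := stationary_estimate d0 m1 beta0 WM st.
have K1 : 0 < K + 1 by rewrite ltr_wpDl.
have b1 : beta * (K + 1) < 1 by rewrite -ltr_pdivlMr// mul1r.
have Kb : K * beta ^+ 2 < 1.
  have : beta < 1 by have := mulr_ge0 (ltW beta0) K0; lra.
  move=> bl; apply: (@le_lt_trans _ _ (K * beta)); last lra.
  by rewrite expr2 mulrA ler_piMr ?(ltW bl)// mulr_ge0// ltW.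
have Dle : \int[vol]_x ((rho x - a) ^+ 2) <= 0.
  rewrite leNgt; apply/negP => D0; move: est; rewrite leNgt => /negP; apply.
  by rewrite gtr_pMl.
have := Rintegral_ge0_eq0 s2 (fun x => sqr_ge0 _) Dle.
apply: filterS => x /= H Dx; have /eqP := H Dx.
by rewrite sqrf_eq0 subr_eq0 => /eqP.
Qed.

End uniqueness.

(** * The free energy *)

Section energy.
Context {R : realType} {d : nat}.
Variable L : R.
Hypothesis L0 : 0 < L.
Implicit Types (x h : 'rV[R]_d) (rho : 'rV[R]_d -> R).

Local Notation vol := (torus_measure L d).
Local Notation a := (rho_infty d L).

(** Integrate the convexity gap with b = a: the linear term integrates to zero
    because rho has the same mass as the constant a. *)
Lemma pressure_gap (m : R) rho : 1 < m -> intg vol rho ->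
  {ae vol, forall x, 0 <= rho x} -> \int[vol]_x rho x = 1 ->
  intg vol (fun x => rho x `^ m) ->
  (m - 1) * a `^ (m - 1) / 4 * (\int[vol]_x `|rho x - a|) ^+ 2 <=
  \int[vol]_x (rho x `^ m) - a `^ m * L ^+ d.
Proof.
move=> m1 ri r0 r1 rmi; set S := \int[vol]_x _.
have a0 := @rho_infty_gt0 _ d _ L0.
set c := (m - 1) * a `^ (m - 1).
have ai k := intg_cst vol k.
have si : intg vol (fun x => rho x - a) by exact: (intgB ri (ai a)).
have sai := intg_norm si.
have sI : \int[vol]_x (rho x - a) = 0.
  rewrite RintegralB//; last exact: ai.
  by rewrite r1 Rintegral_cst// volT// rho_inftyM// subrr.
(* This value maximises 2 t S - 2 t^2, where 2 is the mass of rho + a. *)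
pose t := S / 2.
have li : intg vol (fun x => 2 * t * `|rho x - a| - t ^+ 2 * (rho x + a)).
  by apply: intgB; apply: intgZ => //; exact: (intgD ri (ai a)).
have ui : intg vol (fun x => rho x `^ m - a `^ m - m * a `^ (m - 1) * (rho x - a)).
  by apply: intgB; [exact: (intgB rmi (ai _))|exact: intgZ].
have : \int[vol]_x (c / 2 * (2 * t * `|rho x - a| - t ^+ 2 * (rho x + a))) <=
   \int[vol]_x (rho x `^ m - a `^ m - m * a `^ (m - 1) * (rho x - a)).
  apply: intg_ae_le => //; first exact: intgZ.
  by apply: filterS r0 => x rx; exact: powR_convexity_gap.
rewrite RintegralZl// RintegralB//; last 2 first.
- exact: (intgZ (2 * t) sai).
- exact: (intgZ (t ^+ 2) (intgD ri (ai a))).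
rewrite RintegralZl// RintegralZl//; last exact: (intgD ri (ai a)).
rewrite RintegralD//; last exact: ai.
rewrite r1 Rintegral_cst// volT// rho_inftyM//.
rewrite RintegralB//; last 2 first.
- exact: (intgB rmi (ai _)).
- exact: (intgZ _ si).
rewrite RintegralB//; last exact: ai.
rewrite RintegralZl// sI mulr0 subr0 Rintegral_cst// volT// -/S.
by apply: le_trans; rewrite /t; lra.
Qed.

Section interaction.
Variable W : 'rV[R]_d -> R.
Variable M : R.
Hypothesis pW : torus_periodic L W.
Hypothesis kW : Ck 2 W.
Hypothesis eW : coordinatewise_even W.
Hypothesis W0 : \int[vol]_x W x = 0.
Hypothesis WM : forall x, `|W x| <= M.

Lemma interaction_intg2 rho : intg vol rho ->
  intg2 vol vol (interaction_integrand W rho).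
Proof.
move=> ri; have mrho := intg_measurable ri.
have mW := (W_bounded_measurable L0 pW kW).1.
have mI : measurable_fun setT (interaction_integrand W rho).
  apply: measurable_funM; last exact: (measurableT_comp mrho measurable_snd).
  apply: measurable_funM; last exact: (measurableT_comp mrho measurable_fst).
  exact: (measurableT_comp mW (@measurable_diff R d)).
have ni := intg_norm ri.
apply: (@intg2_iterated _ _ _ _ _ _ _ _ (fun x => M * \int[vol]_y `|rho y| * `|rho x|)) => //.
  exact: intgZ.
move=> x; pose k := M * `|rho x|.
have -> : (M * \int[vol]_y `|rho y| * `|rho x|)%:E = (\int[vol]_y (k * `|rho y|)%:E)%E.
  rewrite -[RHS]fineK; last exact: integrable_fin_num (intgZ k ni).
  by congr (_%:E); rewrite -[RHS]/(\int[vol]_y (k * `|rho y|)) RintegralZl// mulrAC.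
apply: ge0_le_integral => //.
- apply/measurable_EFinP/measurableT_comp => //.
  exact: (measurableT_comp mI (pair1_measurable x)).
- by apply/measurable_EFinP/measurable_funM => //; exact: measurableT_comp.
- move=> y _; rewrite lee_fin !normrM ler_wpM2r// ler_wpM2r//.
Qed.

(** W * s has mean zero, as W has, so one factor rho may be replaced by s, and
    the other one too because W * rho = W * s. *)
Lemma interaction_bound rho : intg vol rho -> \int[vol]_x rho x = 1 ->
  `|\int[(vol \x vol)%E]_z interaction_integrand W rho z| <=
  M * (\int[vol]_x `|rho x - a|) ^+ 2.
Proof.
move=> ri r1; set S := \int[vol]_x _.
pose s x := rho x - a.
have bW := W_bounded_measurable L0 pW kW.
have si : intg vol s by exact: (intgB ri (intg_cst vol a)).
have [_ _ <- _] := Rfubini (interaction_intg2 ri).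
have cE x : convolution L W rho x = convolution L W s x.
  rewrite /convolution; under [RHS]eq_Rintegral do rewrite mulrBr.
  have bx := bounded_measurable_reflect x bW.
  rewrite RintegralB//; last 2 first.
  - by have := intg_mul ri bx; under eq_fun do rewrite mulrC.
  - apply: bounded_measurable_intg; apply: bounded_measurableM => //.
    exact: bounded_measurable_cst.
  have := convolution_W_cst L0 pW kW eW W0 a => /(congr1 (fun f => f x)) /= E.
  by rewrite [X in _ - X]E subr0.
have [mc cM] := convolution_bounded_measurable bW.1 WM si.
have bc : bounded_measurable (convolution L W s).
  by split => //; exists (M * S).
have c0 : \int[vol]_x convolution L W s x = 0.
  have [_ _ _ ->] := Rfubini (convolution_intg2 bW si).
  transitivity (\int[vol]_y (0 : R)); last by rewrite Rintegral_cst// mul0r.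
  apply: eq_Rintegral => y _.
  have shW : \int[vol]_x W (x + - y) = 0 by rewrite Rtorus_shift//; exact: bW.1.
  rewrite /= RintegralZr ?shW ?mul0r//.
  apply: intg_torus_shift => //; exact: bounded_measurable_intg.
have -> : \int[vol]_x \int[vol]_y interaction_integrand W rho (x, y) =
    \int[vol]_x (s x * convolution L W s x).
  transitivity (\int[vol]_x (s x * convolution L W s x + a * convolution L W s x)).
    apply: eq_Rintegral => x _; rewrite -mulrDl subrK -cE /convolution.
    rewrite -RintegralZl//.
      by apply: eq_Rintegral => y _; rewrite /interaction_integrand/= [W _ * _]mulrC mulrA.
    have := intg_mul ri (bounded_measurable_reflect x bW).
    by under eq_fun do rewrite mulrC.
  have ci := bounded_measurable_intg vol bc.
  rewrite RintegralD//; last 2 first.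
  - exact: intg_mul.
  - exact: intgZ.
  by rewrite RintegralZl// c0 mulr0 addr0.
rewrite (le_trans (le_normr_Rintegral measurableT (intg_mul si bc)))//.
have -> : M * S ^+ 2 = \int[vol]_x (M * S * `|s x|).
  by rewrite RintegralZl//; [rewrite expr2 mulrA|exact: intg_norm].
apply: le_Rintegral => //.
- exact: intg_norm (intg_mul si bc).
- exact: intgZ (intg_norm si).
- by move=> x _; rewrite normrM mulrC ler_wpM2r.
Qed.

Lemma RN_density (nu : probability 'rV[R]_d R) : nu `<< vol ->
  [/\ intg vol (torus_density L nu),
     forall A, measurable A -> nu A = (\int[vol]_(x in A) (torus_density L nu x)%:E)%E
   & {ae vol, forall x, 0 <= torus_density L nu x}].
Proof.
move=> numu.
have E : EFin \o torus_density L nu = Radon_Nikodym (charge_of_finite_measure nu) vol.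
  by apply/funext => x /=; rewrite fineK//; exact: Radon_Nikodym_fin_num.
split.
- by rewrite /intg E; exact: Radon_Nikodym_integrable.
- move=> A mA; rewrite -[RHS]/(\int[vol]_(x in A) ((EFin \o torus_density L nu) x))%E E.
  by rewrite -Radon_Nikodym_integral.
- have := ae_eq_Radon_Nikodym_SigmaFinite numu measurableT.
  apply: filterS => x /(_ I) Ex.
  rewrite /torus_density /= fine_ge0// -Ex.
  exact: Radon_Nikodym_SigmaFinite.f_ge0.
Qed.

End interaction.
End energy.

Section minimiser.
Context {R : realType} {d : nat}.
Variable L : R.
Hypothesis L0 : 0 < L.

Local Notation vol := (torus_measure L d).
Local Notation a := (rho_infty d L).

(** The Dirac mass is the default value of the normalisation, taken only for a
    measure of mass zero or infinity. *)
Definition uniform_probability : probability 'rV[R]_d R :=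
  mnormalize vol (\d_(0 : 'rV[R]_d) : probability 'rV[R]_d R).

Lemma uniform_probabilityE (A : set 'rV[R]_d) :
  uniform_probability A = (a%:E * vol A)%E.
Proof.
have vT := torus_measureT d (ltW L0).
rewrite /uniform_probability /= /mnormalize ifF; last first.
  by rewrite [X in X == 0]vT [X in _ || (X == _)]vT orbF eqe gt_eqF// exprn_gt0.
by rewrite muleC [X in fine X]vT.
Qed.

Lemma measurable_torus_cell : measurable (torus_cell L : set 'rV[R]_d).
Proof.
rewrite (_ : torus_cell L = \bigcap_(i in [set: 'I_d])
    ((fun x : 'rV[R]_d => x ord0 i) @^-1` `[0, L[%classic)).
  apply: fin_bigcap_measurable => // i _.
  by rewrite -[X in measurable X]setTI; apply: measurable_coord.
by apply/seteqP; split => [x xL i _|x xL i]; [|have := xL i I]; rewrite /= in_itv/=.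
Qed.

Lemma uniform_torus_probability : torus_probability L uniform_probability.
Proof.
rewrite /torus_probability uniform_probabilityE.
have -> : vol (torus_cell L) = (L ^+ d)%:E.
  apply/eqP; rewrite eq_le; apply/andP; split.
    rewrite -(torus_measureT d (ltW L0)); apply: le_measure; rewrite ?inE//.
    exact: measurable_torus_cell.
  rewrite -(torus_measure_open_cell d L0); apply: le_measure; rewrite ?inE.
  - exact: measurable_open_cell.
  - exact: measurable_torus_cell.
  - by move=> x xL i; have /andP[/ltW -> ->] := xL i.
by rewrite -EFinM rho_inftyM.
Qed.

Lemma uniform_dominated : uniform_probability `<< vol.
Proof.
apply/null_content_dominatesP => A mA A0.
by rewrite [LHS]uniform_probabilityE A0 mule0.
Qed.

(** Both functions have the same integral over every Borel set. *)
Lemma uniform_density : ae_eq vol setT (torus_density L uniform_probability) (cst a).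
Proof.
have [ri rE _] := RN_density uniform_dominated.
suff : ae_eq vol setT (EFin \o torus_density L uniform_probability) (cst a%:E).
  by apply: filterS => x H Dx; have [] := H Dx.
apply: integral_ae_eq => // A _ mA.
by rewrite -rE// integral_cst// uniform_probabilityE.
Qed.

Section energy.
Variable W : 'rV[R]_d -> R.
Variable M : R.
Hypothesis pW : torus_periodic L W.
Hypothesis kW : Ck 2 W.
Hypothesis eW : coordinatewise_even W.
Hypothesis W0 : \int[vol]_x W x = 0.
Hypothesis WM : forall x, `|W x| <= M.
Variables m beta : R.
Hypothesis m1 : 1 < m.
Hypothesis beta0 : 0 < beta.

(** The free energy of the uniform probability; its interaction term vanishes. *)
Definition uniform_energy :=
  beta^-1 / (m - 1) * (a `^ m * L ^+ d) - beta^-1 / (m - 1).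

Lemma density_integral (nu : probability 'rV[R]_d R) : nu `<< vol ->
  \int[vol]_x torus_density L nu x = 1.
Proof.
move=> nuv; have [_ rE _] := RN_density nuv.
by rewrite /Rintegral -rE// probability_setT.
Qed.

Lemma free_energy_uniform :
  free_energy L W m beta uniform_probability = uniform_energy%:E.
Proof.
have [ri _ _] := RN_density uniform_dominated.
have rI := density_integral uniform_dominated.
have ra := uniform_density.
rewrite /free_energy; set rho := torus_density L _ in ri rI ra *.
have mrho := intg_measurable ri.
have mrm : measurable_fun setT (fun x => rho x `^ m).
  exact: (measurableT_comp (measurable_powR m) mrho).
have am : ae_eq vol setT (cst (a `^ m)) (fun x => rho x `^ m).
  by apply: filterS ra => x rx Dx; rewrite rx.
have rmi : intg vol (fun x => rho x `^ m).
  have /integrableP[_ cl] := intg_cst vol (a `^ m).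
  apply/integrableP; split; first exact/measurable_EFinP.
  apply: le_lt_trans cl; rewrite (@ae_eq_integral _ _ _ vol _
    (fun x => `|(a `^ m)%:E|%E))//.
  - by apply/measurable_EFinP/measurableT_comp.
  - by apply: filterS am => x H Dx /=; rewrite -H.
have rmI : \int[vol]_x (rho x `^ m) = a `^ m * L ^+ d.
  by rewrite -(ae_eq_Rintegral (intg_cst _ _) mrm am) Rintegral_cst// volT.
have S0 : \int[vol]_x `|rho x - a| = 0.
  transitivity (\int[vol]_x (0 : R)); last by rewrite Rintegral_cst// mul0r.
  apply: ae_eq_Rintegral => //.
    by apply: intg_norm; apply: intgB => //; exact: intg_cst.
  by apply: filterS ra => x rx Dx; rewrite rx// subrr normr0.
rewrite ifT; last first.
  by apply/asboolP; split => //; [exact: uniform_dominated|exact: interaction_intg2].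
have := interaction_bound L0 pW kW eW W0 WM ri rI.
rewrite S0 expr0n/= mulr0 normr_le0 => /eqP ->.
by rewrite rmI mulr0 addr0.
Qed.

(** The finite case of the free energy, where the convexity gap of the pressure
    competes with the interaction. *)
Lemma free_energy_gap (nu : probability 'rV[R]_d R) :
  free_energy L W m beta nu != +oo%E ->
  nu `<< vol /\ exists2 e, free_energy L W m beta nu = e%:E &
   (a `^ (m - 1) / (4 * beta) - M / 2) *
     (\int[vol]_x `|torus_density L nu x - a|) ^+ 2 <= e - uniform_energy.
Proof.
rewrite /free_energy; case: ifPn => [/asboolP[nuv rmi _] _|_]; last by rewrite eqxx.
split => //; eexists; first by [].
have [ri _ r0] := RN_density nuv.
have rI := density_integral nuv.
have p1 := pressure_gap L0 m1 ri r0 rI rmi.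
have p2 := interaction_bound L0 pW kW eW W0 WM ri rI.
rewrite /uniform_energy; move: p1 p2.
set S := \int[vol]_x `|_ x - _|; set P := \int[vol]_x (_ x `^ _).
set I := \int[_]_z interaction_integrand _ _ z.
rewrite ler_norml => p1 /andP[p2 _].
have k0 : 0 < beta^-1 / (m - 1) by rewrite divr_gt0 ?invr_gt0// subr_gt0.
have := ler_wpM2l (ltW k0) p1.
have -> : beta^-1 / (m - 1) * ((m - 1) * a `^ (m - 1) / 4 * S ^+ 2) =
  a `^ (m - 1) / (4 * beta) * S ^+ 2.
  field.
  by rewrite gt_eqF//= subr_eq0 gt_eqF.
rewrite mulrBr mulrBl; lra.
Qed.

Hypothesis beta_small : 0 < a `^ (m - 1) / (4 * beta) - M / 2.

Lemma uniform_minimiser : free_energy_minimiser L W m beta uniform_probability.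
Proof.
split; first exact: uniform_torus_probability.
move=> nu _; rewrite free_energy_uniform.
have [->|fin] := eqVneq (free_energy L W m beta nu) +oo%E; first exact: leey.
have [_ [e -> He]] := free_energy_gap fin.
rewrite lee_fin -subr_ge0; apply: le_trans He.
by rewrite mulr_ge0 ?sqr_ge0// ltW.
Qed.

Lemma minimiser_unique (mu : probability 'rV[R]_d R) :
  free_energy_minimiser L W m beta mu ->
  forall A, measurable A -> mu A = uniform_probability A.
Proof.
move=> [_ /(_ _ uniform_torus_probability)]; rewrite free_energy_uniform => le A mA.
have fin : free_energy L W m beta mu != +oo%E.
  by apply/eqP => E; move: le; rewrite E.
have [muv [e E He]] := free_energy_gap fin.
have [ri rE _] := RN_density muv.
rewrite rE// uniform_probabilityE -(integral_cst vol mA).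
have si : intg vol (fun x => `|torus_density L mu x - a|).
  by apply: intg_norm; apply: intgB => //; exact: intg_cst.
have S0 : \int[vol]_x `|torus_density L mu x - a| <= 0.
  rewrite leNgt; apply/negP => Sp; move: He; rewrite E lee_fin in le.
  by apply/negP; rewrite -ltNge (@le_lt_trans _ _ 0) ?subr_le0// mulr_gt0// exprn_gt0.
have ra := Rintegral_ge0_eq0 si (fun x => normr_ge0 _) S0.
apply: ae_eq_integral => //.
- by apply/measurable_EFinP; apply: measurable_funTS; exact: intg_measurable ri.
- by apply: filterS ra => x H _ /=; have /eqP := H I; rewrite normr_eq0 subr_eq0 => /eqP ->.
Qed.

End energy.
End minimiser.

(** * The two thresholds combined *)

Theorem lemma5p6 (R : realType) (d : nat) (L : R) (W : 'rV[R]_d -> R) :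
  (0 < d)%N -> 0 < L ->
  torus_periodic L W -> Ck 2 W -> coordinatewise_even W ->
  \int[torus_measure L d]_x W x = 0 ->
  forall m : R, 1 < m ->
  exists beta0 : R, 0 < beta0 /\
  forall beta : R, 0 < beta -> beta < beta0 ->
  [/\ stationary_solution L W m beta (cst (rho_infty d L)),
      forall rho : 'rV[R]_d -> R, stationary_solution L W m beta rho ->
        ae_eq (torus_measure L d) setT rho (cst (rho_infty d L))
    & exists mu_infty : probability 'rV[R]_d R,
      [/\ forall A : set 'rV[R]_d, measurable A ->
            mu_infty A = ((rho_infty d L)%:E * torus_measure L d A)%E,
          free_energy_minimiser L W m beta mu_infty
        & forall mu : probability 'rV[R]_d R,
            free_energy_minimiser L W m beta mu ->
            forall A : set 'rV[R]_d, measurable A -> mu A = mu_infty A]].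
Proof.
move=> d0 L0 pW kW eW W0 m m1.
have [beta1 beta1_gt0 unique1] := stationary_unique L0 pW kW eW W0 d0 m1.
have [_ [M WM]] := W_bounded_measurable L0 pW kW.
have M0 : 0 <= M by exact: le_trans (WM 0).
have a0 : 0 < rho_infty d L `^ (m - 1) by exact/powR_gt0/rho_infty_gt0.
(* Below beta2 the coefficient in free_energy_gap is positive; M + 1 in place of M
   covers the case M = 0. *)
pose beta2 := rho_infty d L `^ (m - 1) / (2 * (M + 1)).
have beta2_gt0 : 0 < beta2 by rewrite divr_gt0// mulr_gt0//; lra.
exists (Order.min beta1 beta2); split; first by rewrite lt_min beta1_gt0.
move=> beta beta0; rewrite lt_min => /andP[beta_lt1 beta_lt2].
have beta_small : 0 < rho_infty d L `^ (m - 1) / (4 * beta) - M / 2.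
  have -> : rho_infty d L `^ (m - 1) = beta2 * (2 * (M + 1)).
    by rewrite /beta2 divfK// gt_eqF// mulr_gt0//; lra.
  rewrite subr_gt0 ltr_pdivlMr ?mulr_gt0//.
  have : 0 < (beta2 - beta) * (2 * (M + 1)).
    by rewrite mulr_gt0 ?subr_gt0// mulr_gt0//; lra.
  lra.
split.
- exact: constant_stationary.
- by move=> rho; exact: unique1.
- exists (uniform_probability L); split.
  + by move=> A _; exact: uniform_probabilityE.
  + exact: (uniform_minimiser L0 pW kW eW W0 WM m1 beta0 beta_small).
  + move=> mu; exact: (minimiser_unique L0 pW kW eW W0 WM m1 beta0 beta_small).
Qed.
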